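(* Let $K/k$ be a purely inseparable extension of characteristic $p>0$ which is of unbounded exponent and $w_0$-generated. Then $K/k$ is $q$-finite if and only if $\mathrm{lm}(K/k)\neq K$.
   Context: All fields have characteristic $p>0$ and all extensions are purely inseparable subextensions of a fixed algebraic closure $\Omega$ of $k$. An extension $K/k$ is of finite (bounded) exponent if $K^{p^e}\subseteq k$ for some $e\in\mathbf N$; otherwise it is of unbounded exponent. A subextension $L/k$ of $K/k$ is given by an intermediate field $k\subseteq L\subseteq K$; it is proper if $L\neq K$. An $r$-basis of $K/k$ is a subset $B\subseteq K$ with $K=k(K^p)(B)$ and $x\notin k(K^p)(B\setminus\{x\})$ for all $x\in B$; all $r$-bases of $K/k$ have the same cardinality. If $K/k$ has finite exponent, $di(K/k)$ denotes the cardinality of an $r$-basis of $K/k$ (equivalently of a minimal generating set). In general the degree of irrationality is $di(K/k)=\sup_{n\ge 1} di\big((k^{p^{-n}}\cap K)/k\big)$ (supremum of cardinals), where $k^{p^{-n}}=\{a\in\Omega : a^{p^n}\in k\}$. $K/k$ is $q$-finite if $di(K/k)$ is finite. $K/k$ is $w_0$-generated if it has no proper subextension $L/k$ of unbounded exponent. $K/k$ is modular if for every $n\in\mathbf N$, $K^{p^n}$ and $k$ are linearly disjoint over $K^{p^n}\cap k$. By a theorem of Waterhouse there is a smallest intermediate field $m$ of $K/k$ such that $K/m$ is modular; it is denoted $\mathrm{lm}(K/k)$. *)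

(* Defs.v *)
From HB Require Import structures.
From mathcomp Require Import all_boot all_algebra.
From mathcomp Require Import boolp classical_sets functions cardinality.

Set Implicit Arguments.
Unset Strict Implicit.
Unset Printing Implicit Defensive.

Import GRing.Theory.
Local Open Scope classical_set_scope.
Local Open Scope card_scope.
Local Open Scope ring_scope.

(* All fields are subfields of an ambient field, represented as Prop-valued
   sets: subfields need not be decidable, and extensions may be infinite. *)

Definition is_subfield (Omega : fieldType) (A : set Omega) : Prop :=
  divring_closed (mem A).

Definition intermediate_field (Omega : fieldType) (k K L : set Omega) : Prop :=
  [/\ is_subfield L, k `<=` L & L `<=` K].

Definition algebraic_over (Omega : fieldType) (k : set Omega) (x : Omega) :
    Prop :=
  exists P : {poly Omega}, [/\ P != 0, P \is a polyOver (mem k) & root P x].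

Definition adjoin (Omega : fieldType) (k S : set Omega) : set Omega :=
  smallest (@is_subfield Omega) (k `|` S).

Definition frob_image (Omega : fieldType) (p n : nat) (K : set Omega) :
    set Omega :=
  [set x ^+ (p ^ n)%N | x in K].

(* The field k^(p^-n) inside the ambient field. *)
Definition frob_preimage (Omega : fieldType) (p n : nat) (k : set Omega) :
    set Omega :=
  [set x | k (x ^+ (p ^ n)%N)].

Definition purely_inseparable (Omega : fieldType) (p : nat)
    (k K : set Omega) : Prop :=
  forall x, K x -> exists n : nat, k (x ^+ (p ^ n)%N).

Definition bounded_exponent (Omega : fieldType) (p : nat)
    (k K : set Omega) : Prop :=
  exists e : nat, frob_image p e K `<=` k.

Definition unbounded_exponent (Omega : fieldType) (p : nat)
    (k K : set Omega) : Prop :=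
  ~ bounded_exponent p k K.

Definition w0_generated (Omega : fieldType) (p : nat)
    (k K : set Omega) : Prop :=
  ~ exists L : set Omega,
      [/\ intermediate_field k K L, L <> K & unbounded_exponent p k L].

Definition r_basis (Omega : fieldType) (p : nat) (k K B : set Omega) : Prop :=
  [/\ B `<=` K,
      K = adjoin (adjoin k (frob_image p 1 K)) B
    & forall x, B x ->
        ~ adjoin (adjoin k (frob_image p 1 K)) (B `\ x) x].

(* |D| bounds di((k^(p^-n) `&` K) / k) for every n >= 1. *)
Definition di_layers_le (Omega : fieldType) (p : nat) (k K : set Omega)
    (T : Type) (D : set T) : Prop :=
  forall n : nat, (0 < n)%N -> forall B : set Omega,
    r_basis p k (frob_preimage p n k `&` K) B -> B #<= D.

(* di(K/k) = |D|.  Cardinals are represented by sets over arbitrary types,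
   compared by #<=, and di(K/k) is the least upper bound of the
   di((k^(p^-n) `&` K) / k), n >= 1. *)
Definition is_di (Omega : fieldType) (p : nat) (k K : set Omega)
    (T : Type) (D : set T) : Prop :=
  di_layers_le p k K D /\
  forall (U : Type) (E : set U), di_layers_le p k K E -> D #<= E.

Definition q_finite (Omega : fieldType) (p : nat) (k K : set Omega) : Prop :=
  exists d : nat, is_di p k K `I_d.

Definition free_over (Omega : fieldType) (C : set Omega) (n : nat)
    (x : 'I_n -> Omega) : Prop :=
  forall c : 'I_n -> Omega, (forall i, C (c i)) ->
    \sum_(i < n) c i * x i = 0 -> forall i, c i = 0.

Definition linearly_disjoint (Omega : fieldType) (C A B : set Omega) : Prop :=
  forall (n : nat) (x : 'I_n -> Omega), (forall i, A (x i)) ->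
    free_over C x -> free_over B x.

Definition modular (Omega : fieldType) (p : nat) (k K : set Omega) : Prop :=
  forall n : nat,
    linearly_disjoint (frob_image p n K `&` k) (frob_image p n K) k.

(* Intersection of the intermediate fields m with K/m modular; lm_smallest
   below shows that it is itself such a field, hence the smallest one. *)
Definition lm (Omega : fieldType) (p : nat) (k K : set Omega) : set Omega :=
  smallest (fun m => intermediate_field k K m /\ modular p m K) k.

Lemma is_subfieldP (Omega : fieldType) (A : set Omega) :
  is_subfield A <-> [/\ A 1, forall x y, A x -> A y -> A (x - y)
                    & forall x y, A x -> A y -> A (x / y)].
Proof.
split=> -[A1 AB AM]; split.
- by move: A1; rewrite inE.
- by move=> x y Ax Ay; apply/set_mem/AB; apply/mem_set.
- by move=> x y Ax Ay; apply/set_mem/AM; apply/mem_set.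
- by apply/mem_set.
- by move=> x y /set_mem Ax /set_mem Ay; apply/mem_set/AB.
- by move=> x y /set_mem Ax /set_mem Ay; apply/mem_set/AM.
Qed.

Lemma subfield0 (Omega : fieldType) (A : set Omega) : is_subfield A -> A 0.
Proof. by move=> /is_subfieldP[A1 AB _]; rewrite -(subrr 1); apply: AB. Qed.

Lemma subfieldN (Omega : fieldType) (A : set Omega) x :
  is_subfield A -> A x -> A (- x).
Proof.
move=> sA Ax; rewrite -sub0r.
by case/is_subfieldP: (sA) => _ + _; apply => //; apply: subfield0.
Qed.

Lemma subfieldD (Omega : fieldType) (A : set Omega) x y :
  is_subfield A -> A x -> A y -> A (x + y).
Proof.
move=> sA Ax Ay; rewrite -[y]opprK.
by case/is_subfieldP: (sA) => _ + _; apply => //; apply: subfieldN.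
Qed.

Lemma subfieldM (Omega : fieldType) (A : set Omega) x y :
  is_subfield A -> A x -> A y -> A (x * y).
Proof.
move=> /is_subfieldP[A1 _ AV] Ax Ay; rewrite -[y]invrK; apply: (AV) => //.
by rewrite -[_^-1]mul1r; apply: AV.
Qed.

Lemma subfieldI (Omega : fieldType) (A B : set Omega) :
  is_subfield A -> is_subfield B -> is_subfield (A `&` B).
Proof.
move=> /is_subfieldP[A1 AB AM] /is_subfieldP[B1 BB BM]; apply/is_subfieldP.
split=> //.
- by move=> x y [? ?] [? ?]; split; [exact: AB | exact: BB].
- by move=> x y [? ?] [? ?]; split; [exact: AM | exact: BM].
Qed.

Lemma subfield_smallest (Omega : fieldType) (C : set Omega -> Prop)
    (G : set Omega) :
  (forall A, C A -> is_subfield A) -> is_subfield (smallest C G).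
Proof.
move=> CA; apply/is_subfieldP; split.
- by move=> A [/CA/is_subfieldP[]].
- move=> x y Gx Gy A CGA; have [/CA/is_subfieldP[_ + _] _] := CGA.
  by apply; [exact: Gx | exact: Gy].
- move=> x y Gx Gy A CGA; have [/CA/is_subfieldP[_ _ +] _] := CGA.
  by apply; [exact: Gx | exact: Gy].
Qed.

Lemma subfield_frob_image (Omega : fieldType) (p n : nat) (K : set Omega) :
  p \in [pchar Omega] -> is_subfield K -> is_subfield (frob_image p n K).
Proof.
move=> charp /is_subfieldP[K1 KB KM]; apply/is_subfieldP.
have nat_pn : [pchar Omega].-nat (p ^ n)%N.
  rewrite (eq_pnat _ (pcharf_eq charp)) pnatX pnat_id //.
  by case/andP: charp.
split.
- by exists 1 => //; rewrite expr1n.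
- move=> _ _ [x Kx <-] [y Ky <-]; exists (x - y); first exact: KB.
  by rewrite exprDn_pchar // exprNn_pchar.
- move=> _ _ [x Kx <-] [y Ky <-]; exists (x / y); first exact: KM.
  by rewrite exprMn exprVn.
Qed.

Lemma linearly_disjoint_sym (Omega : fieldType) (C A B : set Omega) :
  is_subfield C -> is_subfield B -> C `<=` B ->
  linearly_disjoint C A B -> linearly_disjoint C B A.
Proof.
move=> sC sB CB ldAB; elim=> [|n IHn] y By freey a Aa eqay.
  by case.
have [freea|] := pselect (free_over C a).
  have y0 : forall i, y i = 0.
    apply: (ldAB _ _ Aa freea) => //.
    by rewrite -[RHS]eqay; apply: eq_bigr => i _; rewrite mulrC.
  have /eqP : (1 : Omega) = 0; last by rewrite oner_eq0.
  apply: (freey (fun=> 1) _ _ ord0) => [i|].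
    by case/is_subfieldP: sC.
  by rewrite big1 // => i _; rewrite y0 mulr0.
move=> /existsNP[c /not_implyP[Cc /not_implyP[eqca /existsNP[j0 /eqP cj0]]]].
pose d j := c j / c j0.
have Cd j : C (d j) by case/is_subfieldP: sC => _ _; apply.
have dj0 : d j0 = 1 by rewrite /d divff.
have eqda : \sum_j d j * a j = 0.
  under eq_bigr do rewrite /d mulrAC.
  by rewrite -mulr_suml eqca mul0r.
have aj0 : a j0 = - \sum_j d (lift j0 j) * a (lift j0 j).
  apply/eqP; rewrite -addr_eq0; apply/eqP.
  by rewrite -[RHS]eqda (bigD1_ord j0) //= dj0 mul1r.
pose y' j := y (lift j0 j) - d (lift j0 j) * y j0.
have a0 j : a (lift j0 j) = 0.
  apply: (IHn y' _ _ (fun j => a (lift j0 j))) => // [i|c' Cc' eqc'|].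
  - rewrite /y'; apply: subfieldD => //; apply: subfieldN => //.
    by apply: subfieldM => //; apply: CB.
  - pose e i := if unlift j0 i is Some i' then c' i'
                else - \sum_i' c' i' * d (lift j0 i').
    have e0 : forall i, e i = 0.
      apply: freey => [i|].
        rewrite /e; case: unliftP => [i' _|_]; first exact: Cc'.
        apply: subfieldN => //; elim/big_rec: _ => [|i' z _ Cz].
          exact: subfield0.
        by apply: subfieldD => //; apply: subfieldM.
      rewrite (bigD1_ord j0) //= {1}/e unlift_none mulNr mulr_suml addrC.
      rewrite -sumrB -[RHS]eqc'; apply: eq_bigr => i _.
      by rewrite /e liftK /y' mulrBr [in RHS]mulrA.
    by move=> i; have := e0 (lift j0 i); rewrite /e liftK.
  - rewrite -[RHS]eqay (bigD1_ord j0) //= {1}aj0 mulNr mulr_suml addrC.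
    rewrite -sumrB; apply: eq_bigr => i _.
    by rewrite /y' mulrBr; congr (_ - _); rewrite mulrA [d _ * _]mulrC.
move=> i; case: (unliftP j0 i) => [j ->|->]; first exact: a0.
by rewrite aj0 big1 ?oppr0 // => j _; rewrite a0 mulr0.
Qed.

Lemma linearly_disjoint_bigcap (Omega : fieldType) (M : set Omega)
    (Fam : set (set Omega)) :
  is_subfield M -> (forall F, Fam F -> is_subfield F) ->
  (forall F, Fam F -> linearly_disjoint (M `&` F) F M) ->
  linearly_disjoint (M `&` \bigcap_(F in Fam) F) (\bigcap_(F in Fam) F) M.
Proof.
move=> sM sF ldF; elim=> [|n IHn] x Fx freex m Mm eqm; first by case.
apply: contrapT => /existsNP[j0 /eqP mj0].
have sMI : is_subfield (M `&` \bigcap_(F in Fam) F).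
  apply: subfieldI => //.
  have -> : \bigcap_(F in Fam) F = smallest Fam set0.
    congr bigcap; apply/seteqP; split=> [F FF|F []] //.
    by split=> //; exact: sub0set.
  exact: subfield_smallest.
have free' : free_over M (fun j => x (lift j0 j)).
  apply: IHn => [i|c Cc eqc i]; first exact: Fx.
  pose e i := if unlift j0 i is Some i' then c i' else 0.
  have e0 : forall i, e i = 0.
    apply: freex => [l|].
      by rewrite /e; case: unliftP => [i' _|_]; [exact: Cc|exact: subfield0].
    rewrite (bigD1_ord j0) //= {1}/e unlift_none mul0r add0r -[RHS]eqc.
    by apply: eq_bigr => l _; rewrite /e liftK.
  by have := e0 (lift j0 i); rewrite /e liftK.
pose u j := m j / m j0.
have Mu j : M (u j) by case/is_subfieldP: sM => _ _; apply.
have uj0 : u j0 = 1 by rewrite /u divff.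
have equ : \sum_j u j * x j = 0.
  under eq_bigr do rewrite /u mulrAC.
  by rewrite -mulr_suml eqm mul0r.
have /eqP : u j0 = 0; last by rewrite uj0 oner_eq0.
apply: (freex u) => // i; split=> // F FF.
have : ~ free_over (M `&` F) x.
  move=> freeF; have xF j : F (x j) by exact: Fx.
  by move/eqP: (ldF F FF _ x xF freeF u Mu equ j0); rewrite uj0 oner_eq0.
move=> /existsNP[c /not_implyP[MFc /not_implyP[eqc /existsNP[l /eqP cl]]]].
have cj0 : c j0 != 0.
  apply: contraNneq cl => cj0.
  suff c0 j : c (lift j0 j) = 0.
    by case: (unliftP j0 l) => [j ->|->]; rewrite ?c0 ?cj0.
  apply: (free' (fun j => c (lift j0 j))) => [j'|]; first by have [] := MFc (lift j0 j').
  by rewrite -[RHS]eqc (bigD1_ord j0) //= cj0 mul0r add0r.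
pose v j := c j / c j0.
have sMF : is_subfield (M `&` F) by apply: subfieldI => //; apply: sF.
have MFv j : (M `&` F) (v j) by case/is_subfieldP: sMF => _ _; apply.
have vj0 : v j0 = 1 by rewrite /v divff.
have eqv : \sum_j v j * x j = 0.
  under eq_bigr do rewrite /v mulrAC.
  by rewrite -mulr_suml eqc mul0r.
suff -> : u i = v i by have [] := MFv i.
case: (unliftP j0 i) => [j ->|->]; last by rewrite uj0 vj0.
apply/eqP; rewrite -subr_eq0; apply/eqP.
apply: (free' (fun j => u (lift j0 j) - v (lift j0 j))) => [j'|].
  by apply: subfieldD => //; apply: subfieldN => //; have [] := MFv (lift j0 j').
under eq_bigr do rewrite mulrBl.
rewrite sumrB; apply/eqP; rewrite subr_eq0; apply/eqP; apply: (addrI (x j0)).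
move: equ eqv; rewrite !(bigD1_ord j0) //= uj0 vj0 !mul1r => -> ->.
by [].
Qed.

Lemma lm_smallest (Omega : fieldType) (p : nat) (k K : set Omega) :
  p \in [pchar Omega] -> is_subfield K -> k `<=` K ->
  [/\ intermediate_field k K (lm p k K), modular p (lm p k K) K
    & forall m, intermediate_field k K m -> modular p m K -> lm p k K `<=` m].
Proof.
move=> charp sK kK.
have sM n : is_subfield (frob_image p n K) by exact: subfield_frob_image.
have lm_min m : intermediate_field k K m -> modular p m K -> lm p k K `<=` m.
  by move=> im mm; apply: smallest_sub => //; case: im.
have modK : modular p K K.
  move=> n; have MK : frob_image p n K `<=` K.
    move=> _ [x Kx <-]; elim: (p ^ n)%N => [|e IHe].
      by rewrite expr0; case/is_subfieldP: sK.
    by rewrite exprS; apply: subfieldM.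
  rewrite (setIidl MK); apply: linearly_disjoint_sym => //.
have sL : is_subfield (lm p k K).
  by apply: subfield_smallest => A [[]].
split=> //.
  split=> //; first by apply: sub_smallest; exact: subset_refl.
  by apply: lm_min => //; split=> //; exact: subset_refl.
move=> n; apply: linearly_disjoint_sym => //.
- exact: subfieldI.
- apply: linearly_disjoint_bigcap => // F; first by case=> [[[]]].
  case=> [[[sF _ _] modF] _]; apply: linearly_disjoint_sym => //.
  exact: subfieldI.
Qed.

(* Main.v *)
(** Write K_n for the elements x of K with x^(p^n) in k, and k(A^(p^i)) for the
    field generated by the p^i-th powers of A.

    Suppose K/k is q-finite.  All degrees [K_n : k(K_n^p)] are then at most some
    q, and for fixed g the chain k(K_(g+t)^(p^t)) decreases with t inside the
    finite extension K_g, so it is stationary, with value B_g say.  The B_g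
    increase, k(B_(g+1)^p) = B_g, and their union has unbounded exponent, so it
    is K by w_0-generation.  The degrees [B_(g+1) : B_g] are nondecreasing in g
    and bounded by q, hence constant from some g_0 on, and this makes K modular
    over B_(g_0): the p^n-th powers of a generating system of B_(g_0+N) over
    B_(g_0+n) span B_(g_0+N-n) over B_(g_0), and by counting they are a basis.

    Conversely let m = lm(K/k) be proper.  It has bounded exponent e over k, and
    K = k(K^(p^j)) for all j by w_0-generation.  Let M_n be m^(p^-n) within K.
    Modularity gives M_n = m(M_(n+j)^(p^j)); if [M_1 : m] were infinite, one
    could therefore adjoin to m elements of larger and larger exponent while
    avoiding some y in M_1, contradicting w_0-generation.  So [M_1 : m] = D is
    finite, modularity bounds [M_(n+1) : M_n] by D, and K is the union of the
    finite extensions F' = k(M_n^(p^e)) of k, for which [F' : k(F'^p)] <= D.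
    Since [F : k(F^p)] <= [F' : k(F'^p)] for F inside F', every r-basis of
    every K_n has at most D elements. *)

Require Import Defs.
From mathcomp Require Import all_boot all_algebra.
From mathcomp Require Import boolp classical_sets functions cardinality.

Set Implicit Arguments.
Unset Strict Implicit.
Unset Printing Implicit Defensive.

Import GRing.Theory.
Local Open Scope classical_set_scope.
Local Open Scope card_scope.
Local Open Scope ring_scope.

(** * Linear algebra over a subfield *)

Section SubfieldTheory.
Variables (Omega : fieldType).
Implicit Types (A B C S : set Omega).

Lemma subfield1 C : is_subfield C -> C 1.
Proof. by case/is_subfieldP. Qed.

Lemma subfield_div C x y : is_subfield C -> C x -> C y -> C (x / y).
Proof. by case/is_subfieldP=> _ _; apply. Qed.

Lemma subfieldX C x n : is_subfield C -> C x -> C (x ^+ n).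
Proof.
move=> sC Cx; elim: n => [|n IHn]; first exact: subfield1.
by rewrite exprS; apply: subfieldM.
Qed.

Lemma subfield_sum C (I : finType) (f : I -> Omega) :
  is_subfield C -> (forall i, C (f i)) -> C (\sum_i f i).
Proof.
move=> sC Cf; elim/big_rec: _ => [|i z _ Cz]; first exact: subfield0.
exact: subfieldD.
Qed.

Lemma subfield_bigcup (F : nat -> set Omega) :
  (forall n, is_subfield (F n)) ->
  (forall m n, (m <= n)%N -> F m `<=` F n) -> is_subfield (\bigcup_n F n).
Proof.
move=> sF leF; apply/is_subfieldP; split.
- by exists 0%N => //; apply: subfield1.
- move=> x y [m _ Fx] [n _ Fy]; exists (maxn m n) => //.
  apply: subfieldD => //; first exact: leF (leq_maxl _ _) _ Fx.
  by apply: subfieldN => //; apply: leF (leq_maxr _ _) _ Fy.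
- move=> x y [m _ Fx] [n _ Fy]; exists (maxn m n) => //.
  apply: subfield_div => //; first exact: leF (leq_maxl _ _) _ Fx.
  exact: leF (leq_maxr _ _) _ Fy.
Qed.

Lemma subfield_adjoin C S : is_subfield (adjoin C S).
Proof. exact: subfield_smallest. Qed.

Lemma sub_adjoinl C S : C `<=` adjoin C S.
Proof. by move=> x Cx; apply: sub_gen_smallest; left. Qed.

Lemma sub_adjoinr C S : S `<=` adjoin C S.
Proof. by move=> x Sx; apply: sub_gen_smallest; right. Qed.

Lemma adjoin_min C S A :
  is_subfield A -> C `<=` A -> S `<=` A -> adjoin C S `<=` A.
Proof. by move=> sA CA SA; apply: smallest_sub => //; rewrite subUset. Qed.

Lemma adjoinS C S A B : C `<=` A -> S `<=` B -> adjoin C S `<=` adjoin A B.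
Proof.
move=> CA SB; apply: adjoin_min; first exact: subfield_adjoin.
  exact: subset_trans CA (@sub_adjoinl _ _).
exact: subset_trans SB (@sub_adjoinr _ _).
Qed.

Lemma adjoin_setU C S T : adjoin C (S `|` T) = adjoin (adjoin C S) T.
Proof.
apply/seteqP; split.
  apply: adjoin_min; first exact: subfield_adjoin.
    by move=> x Cx; do 2 apply: sub_adjoinl.
  move=> x [Sx|Tx]; last exact: sub_adjoinr.
  by apply: sub_adjoinl; apply: sub_adjoinr.
apply: adjoin_min; first exact: subfield_adjoin.
  by apply: adjoinS => // x; left.
by move=> x Tx; apply: sub_adjoinr; right.
Qed.

Definition lincomb C (n : nat) (u : 'I_n -> Omega) : set Omega :=
  [set z | exists2 c : 'I_n -> Omega, (forall i, C (c i))
                                    & z = \sum_i c i * u i].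

(** The family [u] need not lie in [A], so the bound passes to subsets of [A]. Neither here nor in
    [has_basis] must [A] be a [C]-space. *)
Definition fin_span C A n := exists u : 'I_n -> Omega, A `<=` lincomb C u.

Definition has_basis C A n := exists x : 'I_n -> Omega,
  [/\ forall i, A (x i), free_over C x & A `<=` lincomb C x].

Lemma sub_fin_span C A B n : A `<=` B -> fin_span C B n -> fin_span C A n.
Proof. by move=> AB [u Bu]; exists u; apply: subset_trans Bu. Qed.

Lemma basis_fin_span C A n : has_basis C A n -> fin_span C A n.
Proof. by case=> x [_ _ Ax]; exists x. Qed.

Lemma free_inj C m n (x : 'I_n -> Omega) (f : 'I_m -> 'I_n) :
  is_subfield C -> injective f -> free_over C x -> free_over C (x \o f).
Proof.
move=> sC fI freex c Cc eqc i.
(* Extension of [c] by zero off the image of [f]; each fibre has at most one element. *)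
pose d j := \sum_(i | f i == j) c i.
have dE k : d (f k) = c k.
  by rewrite /d (eq_bigl (pred1 k)) ?big_pred1_eq // => l; rewrite /= inj_eq.
rewrite -dE; apply: freex => [j|].
  rewrite /d; elim/big_rec: _ => [|l z _ Cz]; first exact: subfield0.
  exact: subfieldD.
rewrite -[RHS]eqc.
under eq_bigr => j _ do rewrite /d mulr_suml.
rewrite (exchange_big_dep predT) //=; apply: eq_bigr => l _.
by rewrite (big_pred1 (f l)) // => j; rewrite /= eq_sym.
Qed.

Definition fcons n (z : Omega) (x : 'I_n -> Omega) (i : 'I_n.+1) : Omega :=
  if unlift ord0 i is Some j then x j else z.

Lemma fcons0 n z (x : 'I_n -> Omega) : fcons z x ord0 = z.
Proof. by rewrite /fcons unlift_none. Qed.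

Lemma fconsS n z (x : 'I_n -> Omega) i : fcons z x (lift ord0 i) = x i.
Proof. by rewrite /fcons liftK. Qed.

Lemma free_fcons C n z (x : 'I_n -> Omega) :
  is_subfield C -> free_over C x -> ~ lincomb C x z -> free_over C (fcons z x).
Proof.
move=> sC freex nxz c Cc; rewrite big_ord_recl fcons0.
under eq_bigr do rewrite fconsS.
move=> eqc; have c0 : c ord0 = 0.
  apply/eqP/negPn/negP => c0; apply: nxz.
  exists (fun i => - (c (lift ord0 i) / c ord0)) => [i|].
    by apply: subfieldN => //; apply: subfield_div.
  have := divff c0 => c1.
  under eq_bigr do rewrite mulNr mulrAC.
  rewrite sumrN -mulr_suml; apply: (mulfI c0).
  by rewrite mulrN mulrCA divff // mulr1; apply/eqP; rewrite -addr_eq0 eqc.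
move: eqc; rewrite c0 mul0r add0r => /(freex (c \o lift ord0)) c'0 i.
case: (unliftP ord0 i) => [j|] -> //.
by apply: c'0 => l; apply: Cc.
Qed.

(** Gaussian elimination: a row with nonzero first entry clears the first column of the other rows,
    and a relation among these shortened rows lifts back. *)
Lemma coef_dep C n (a : 'I_n.+1 -> 'I_n -> Omega) :
  is_subfield C -> (forall i j, C (a i j)) ->
  exists c : 'I_n.+1 -> Omega, [/\ forall i, C (c i), exists i, c i != 0
    & forall j, \sum_i c i * a i j = 0].
Proof.
move=> sC; elim: n a => [|n IHn] a Ca.
  exists (fun=> 1); split=> [_||[]//]; first exact: subfield1.
  by exists ord0; rewrite oner_neq0.
have [a0|/existsNP[i0 /eqP ai0]] := pselect (forall i, a i ord0 = 0).
  have [i j|c [Cc [i ci] c0]] := IHn (fun i j => a (lift ord0 i) (lift ord0 j)).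
    exact: Ca.
  exists (fcons 0 c); split.
  - move=> j; case: (unliftP ord0 j) => [l|] ->; rewrite ?fconsS ?fcons0 //.
    exact: subfield0.
  - by exists (lift ord0 i); rewrite fconsS.
  - move=> j; case: (unliftP ord0 j) => [l|] ->.
      rewrite big_ord_recl fcons0 mul0r add0r -[RHS](c0 l).
      by apply: eq_bigr => k _; rewrite fconsS.
    by rewrite big1 // => k _; rewrite a0 mulr0.
pose r i := a (lift i0 i) ord0 / a i0 ord0.
have Cr i : C (r i) by apply: subfield_div.
pose b i j := a (lift i0 i) (lift ord0 j) - r i * a i0 (lift ord0 j).
have [|c [Cc [i ci] c0]] := IHn b.
  move=> i j; apply: subfieldD => //; apply: subfieldN => //.
  by apply: subfieldM.
pose d i := if unlift i0 i is Some l then c l else - \sum_l c l * r l.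
have dl l : d (lift i0 l) = c l by rewrite /d liftK.
have d0 : d i0 = - \sum_l c l * r l by rewrite /d unlift_none.
have eqd j : \sum_l d l * a l j =
  \sum_l c l * (a (lift i0 l) j - r l * a i0 j).
  rewrite (bigD1_ord i0) //= d0 mulNr mulr_suml addrC -sumrB.
  by apply: eq_bigr => l _; rewrite dl mulrBr -mulrA.
exists d; split.
- move=> j; case: (unliftP i0 j) => [l|] ->; rewrite ?dl ?d0 //.
  apply: subfieldN => //; apply: subfield_sum => // l; exact: subfieldM.
- by exists (lift i0 i); rewrite dl.
- move=> j; rewrite eqd; case: (unliftP ord0 j) => [l|] ->; first exact: c0.
  by rewrite big1 // => k _; rewrite /r divfK // subrr mulr0.
Qed.

(** Steinitz bound: if r > n, the coordinate rows of n+1 of the [x i] would be dependent by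
    [coef_dep]. *)
Lemma free_span_leq C r n (x : 'I_r -> Omega) (u : 'I_n -> Omega) :
  is_subfield C -> free_over C x -> (forall i, lincomb C u (x i)) -> (r <= n)%N.
Proof.
move=> sC freex xu; rewrite leqNgt; apply/negP => ltnr.
have inj_w : injective (widen_ord ltnr) by move=> i j /(congr1 val) /= /val_inj.
have freew := free_inj sC inj_w freex.
have /choice[a aP] : forall i, exists c : 'I_n -> Omega, (forall j, C (c j)) /\
    x (widen_ord ltnr i) = \sum_j c j * u j.
  by move=> i; have [c Cc ->] := xu (widen_ord ltnr i); exists c.
have [i j|c [Cc [i ci] c0]] := @coef_dep C n a sC.
  by have [] := aP i.
move/eqP: ci; apply; apply: freew => //=.
under eq_bigr => l _ do rewrite (proj2 (aP l)) mulr_sumr.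
rewrite exchange_big big1 //= => j _.
under eq_bigr do rewrite mulrA.
by rewrite -mulr_suml c0 mul0r.
Qed.

(** A free family in [A] of maximal length spans [A], since a vector outside its span could be
    prepended. *)
Lemma bounded_free_has_basis C A N :
  is_subfield C ->
  (forall r (x : 'I_r -> Omega), (forall i, A (x i)) -> free_over C x ->
     (r <= N)%N) ->
  exists2 n, (n <= N)%N & has_basis C A n.
Proof.
move=> sC bnd.
pose P n := `[< exists x : 'I_n -> Omega, (forall i, A (x i)) /\ free_over C x >].
have exP : exists n, P n.
  by exists 0%N; apply/asboolP; exists (fun=> 0); split=> [[]//|c _ _ []].
have leP n : P n -> (n <= N)%N by move=> /asboolP[x [Ax /bnd]]; apply.
case: (ex_maxnP exP leP) => n /asboolP[x [Ax freex]] maxn.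
exists n; first by apply: leP; apply/asboolP; exists x.
exists x; split=> // z Az; apply: contrapT => nz.
suff: (n.+1 <= n)%N by rewrite ltnn.
apply: maxn; apply/asboolP; exists (fcons z x); split; last exact: free_fcons.
by move=> i; case: (unliftP ord0 i) => [j|] ->; rewrite ?fconsS ?fcons0.
Qed.

Lemma fin_span_has_basis C A n : is_subfield C -> fin_span C A n ->
  exists2 r, (r <= n)%N & has_basis C A r.
Proof.
move=> sC [u Au]; apply: bounded_free_has_basis => // r x Ax freex.
by apply: free_span_leq sC freex _ => i; apply/Au.
Qed.

Lemma basis_leq C A r n :
  is_subfield C -> has_basis C A r -> fin_span C A n -> (r <= n)%N.
Proof.
move=> sC [x [Ax freex _]] [u Au].
by apply: free_span_leq sC freex _ => i; apply/Au.
Qed.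

Lemma lincomb_leq C n r (u : 'I_n -> Omega) (v : 'I_r -> Omega) :
  is_subfield C -> (forall i, lincomb C v (u i)) -> lincomb C u `<=` lincomb C v.
Proof.
move=> sC uv z [c Cc ->].
have /choice[a aP] : forall i, exists a : 'I_r -> Omega, (forall j, C (a j)) /\
    u i = \sum_j a j * v j.
  by move=> i; have [a Ca ->] := uv i; exists a.
exists (fun j => \sum_i c i * a i j) => [j|].
  apply: subfield_sum => // i; apply: subfieldM => //; exact: (aP i).1.
under eq_bigr => i _ do rewrite (aP i).2 mulr_sumr.
rewrite exchange_big; apply: eq_bigr => j _ /=.
by rewrite mulr_suml; apply: eq_bigr => i _; rewrite mulrA.
Qed.

Lemma free_leq_span C A n (x : 'I_n -> Omega) :
  is_subfield C -> (forall i, A (x i)) -> free_over C x -> fin_span C A n ->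
  A `<=` lincomb C x.
Proof.
move=> sC Ax freex [u Au] z Az; apply: contrapT => nz.
suff: (n.+1 <= n)%N by rewrite ltnn.
apply: (free_span_leq sC (free_fcons sC freex nz) (u := u)) => i.
by case: (unliftP ord0 i) => [j|] ->; rewrite ?fconsS ?fcons0; apply: Au.
Qed.

(** If one vector depended on the others, the remaining n - 1 would still span a free family of n
    vectors. *)
Lemma span_basis_free C A n (u : 'I_n -> Omega) :
  is_subfield C -> has_basis C A n -> A `<=` lincomb C u -> free_over C u.
Proof.
move=> sC [x [Ax freex _]] Au c Cc c0 i; apply/eqP/negPn/negP => ci.
case: n i c u Au c0 ci Cc x Ax freex => [[]//|n] i c u Au c0 ci Cc x Ax freex.
suff: (n.+1 <= n)%N by rewrite ltnn.
apply: (free_span_leq sC freex (u := u \o lift i)) => j.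
apply: (@lincomb_leq _ n.+1 _ u) (Au _ (Ax j)) => // l.
case: (unliftP i l) => [k|] ->.
  exists (fun k' => (k' == k)%:R) => [k'|].
    by case: eqP => _; [exact: subfield1|exact: subfield0].
  rewrite (bigD1 k) //= eqxx mul1r big1 ?addr0 // => k' /negPf->.
  by rewrite mul0r.
exists (fun k => - (c (lift i k) / c i)) => [k|].
  by apply: subfieldN => //; apply: subfield_div.
under eq_bigr do rewrite mulNr mulrAC.
rewrite sumrN -mulr_suml; apply: (mulfI ci).
rewrite mulrN mulrCA divff // mulr1; apply/eqP; rewrite -addr_eq0.
by rewrite -[X in _ == X]c0 (bigD1_ord i).
Qed.

Lemma ord_prod_bij m n :
  exists w : 'I_(m * n) -> 'I_m * 'I_n, bijective w.
Proof.
have e : (m * n = #|{: 'I_m * 'I_n}|)%N by rewrite card_prod !card_ord.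
exists (enum_val \o cast_ord e); apply: bij_comp.
  exists enum_rank; [exact: enum_valK|exact: enum_rankK].
by exists (cast_ord (esym e)); [exact: cast_ordK|exact: cast_ordKV].
Qed.

(** The products x_i y_j of the tower law, enumerated through [w] because families are indexed by
    ordinals. *)
Definition prodfam m n (x : 'I_m -> Omega) (y : 'I_n -> Omega)
  (w : 'I_(m * n) -> 'I_m * 'I_n) i := x (w i).1 * y (w i).2.

Lemma sum_prodfam m n (x : 'I_m -> Omega) (y : 'I_n -> Omega) w
    (c : 'I_m -> 'I_n -> Omega) : bijective w ->
  \sum_i c (w i).1 (w i).2 * prodfam x y w i =
  \sum_i (\sum_j c i j * y j) * x i.
Proof.
case=> w' wK w'K; rewrite (reindex w') /=; last by exists w => i _.
under eq_bigr => i _ do rewrite /prodfam w'K.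
transitivity (\sum_i \sum_j c i j * (x i * y j)).
  by rewrite pair_big.
apply: eq_bigr => i _; rewrite mulr_suml; apply: eq_bigr => j _.
by rewrite mulrA mulrAC.
Qed.

Lemma span_prodfam C B A m n (x : 'I_m -> Omega) (y : 'I_n -> Omega) w :
  bijective w -> A `<=` lincomb B x -> B `<=` lincomb C y ->
  A `<=` lincomb C (prodfam x y w).
Proof.
move=> wbij Ax By z /Ax[b Bb ->].
have /choice[c cP] : forall i, exists c : 'I_n -> Omega, (forall j, C (c j)) /\
    b i = \sum_j c j * y j.
  by move=> i; have [c Cc ->] := By _ (Bb i); exists c.
exists (fun i => c (w i).1 (w i).2) => [i|]; first exact: (cP _).1.
by rewrite sum_prodfam //; apply: eq_bigr => i _; rewrite (cP i).2.
Qed.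

Lemma free_prodfam C B m n (x : 'I_m -> Omega) (y : 'I_n -> Omega) w :
  is_subfield B -> C `<=` B -> bijective w -> (forall j, B (y j)) ->
  free_over B x -> free_over C y -> free_over C (prodfam x y w).
Proof.
move=> sB CB wbij By freex freey c Cc; have [w' wK w'K] := wbij.
pose d i j := c (w' (i, j)).
have dE i : c i = d (w i).1 (w i).2 by rewrite /d -surjective_pairing wK.
under eq_bigr do rewrite dE.
rewrite sum_prodfam // => /freex d0 i; rewrite dE; apply: freey.
  by move=> j; apply: Cc.
by apply: d0 => l; apply: subfield_sum => // j; apply: subfieldM => //; apply/CB/Cc.
Qed.

Lemma fin_span_tower C B A m n :
  fin_span B A m -> fin_span C B n -> fin_span C A (m * n).
Proof.
move=> [x Ax] [y By]; have [w wbij] := ord_prod_bij m n.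
by exists (prodfam x y w); apply: span_prodfam Ax By.
Qed.

Lemma has_basis_tower C B A m n :
  is_subfield C -> is_subfield A -> is_subfield B -> C `<=` B -> B `<=` A ->
  has_basis B A m -> has_basis C B n -> has_basis C A (m * n).
Proof.
move=> sC sA sB CB BA [x [Ax freex xA]] [y [By freey yB]].
have [w wbij] := ord_prod_bij m n.
exists (prodfam x y w); split; [|exact: free_prodfam freex freey|exact: span_prodfam xA yB].
by move=> i; apply: subfieldM => //; apply: BA.
Qed.

Lemma has_basis_self C : is_subfield C -> has_basis C C 1.
Proof.
move=> sC; exists (fun=> 1); split=> [_|c _|z Cz]; first exact: subfield1.
  by rewrite big_ord1 mulr1 => c0 i; rewrite ord1.
by exists (fun=> z) => //; rewrite big_ord1 mulr1.
Qed.

Lemma has_basis_sub_eq C A B n :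
  is_subfield C -> A `<=` B -> has_basis C A n -> has_basis C B n ->
  is_subfield A -> C `<=` A -> A = B.
Proof.
move=> sC AB [x [Ax freex _]] bB sA CA; apply/seteqP; split=> // z Bz.
have [] := free_leq_span sC _ freex (basis_fin_span bB) Bz.
  by move=> i; apply: AB.
move=> c Cc ->; apply: subfield_sum => // i.
by apply: subfieldM => //; apply: CA.
Qed.

(** The dimension over [C] attains its minimum at some [T]; from there on, inclusions between spaces
    of equal dimension are equalities. *)
Lemma descending_stationary C (V : nat -> set Omega) N :
  is_subfield C -> (forall t, is_subfield (V t)) -> (forall t, C `<=` V t) ->
  (forall s t, (s <= t)%N -> V t `<=` V s) -> fin_span C (V 0%N) N ->
  exists T, forall t, (T <= t)%N -> V t = V T.
Proof.
move=> sC sV CV Vle fV.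
pose P n := `[< exists t, has_basis C (V t) n >].
have exb t : exists n, has_basis C (V t) n.
  have [r _ br] := fin_span_has_basis sC (sub_fin_span (Vle _ _ (leq0n t)) fV).
  by exists r.
have exP : exists n, P n by have [n bn] := exb 0%N; exists n; apply/asboolP; exists 0%N.
case: (ex_minnP exP) => n /asboolP[T bT] minn; exists T => t leTt.
have [r br] := exb t.
have ern : r = n.
  apply/eqP; rewrite eqn_leq minn; last by apply/asboolP; exists t.
  by rewrite (basis_leq sC br) //; apply: sub_fin_span (Vle _ _ leTt) (basis_fin_span bT).
by apply: has_basis_sub_eq bT _ _ => //; [exact: Vle|rewrite -ern].
Qed.

Lemma fin_span_leq C A m n :
  is_subfield C -> (m <= n)%N -> fin_span C A m -> fin_span C A n.
Proof.
move=> sC /subnK <-; elim: (n - m)%N => // l IHl /IHl[u Au].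
exists (fcons 0 u) => z /Au[c Cc ->]; exists (fcons 0 c) => [i|].
  case: (unliftP ord0 i) => [j|] ->; rewrite ?fconsS ?fcons0 //.
  exact: subfield0.
rewrite big_ord_recl !fcons0 mul0r add0r.
by apply: eq_bigr => i _; rewrite !fconsS.
Qed.

Lemma fin_spanSl C D A n : C `<=` D -> fin_span C A n -> fin_span D A n.
Proof.
move=> CD [u Au]; exists u => z /Au[c Cc ->]; exists c => // i.
by apply: CD.
Qed.

Lemma lincombSl C D n (u : 'I_n -> Omega) :
  C `<=` D -> lincomb C u `<=` lincomb D u.
Proof. by move=> CD z [c Cc ->]; exists c => // i; apply: CD. Qed.

Lemma mem_lincomb C n (u : 'I_n -> Omega) i : is_subfield C -> lincomb C u (u i).
Proof.
move=> sC; exists (fun j => (j == i)%:R) => [j|].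
  by case: eqP => _; [exact: subfield1|exact: subfield0].
rewrite (bigD1 i) //= eqxx mul1r big1 ?addr0 // => j /negPf->.
by rewrite mul0r.
Qed.

(** Coefficients descend from [B] to [C]: if [y] were outside the [C]-span of the [a i], it would
    extend a basis of that span to a family free over [C], hence over [B], against the given
    [B]-relation. *)
Lemma linearly_disjoint_lincomb C A B n (a : 'I_n -> Omega) y :
  is_subfield C -> is_subfield B -> C `<=` B -> linearly_disjoint C A B ->
  (forall i, A (a i)) -> A y -> lincomb B a y -> lincomb C a y.
Proof.
move=> sC sB CB ldAB Aa Ay Bay.
have [r _ [x [ax freex xa]]] : exists2 r, (r <= n)%N & has_basis C (range a) r.
  apply: fin_span_has_basis => //; exists a => _ [i _ <-]; exact: mem_lincomb.
suff Cxy : lincomb C x y.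
  apply: (lincomb_leq sC _ Cxy) => i; have [j _ <-] := ax i; exact: mem_lincomb.
apply: contrapT => nxy.
have [c Bc eqy] : lincomb B x y.
  apply: (lincomb_leq sB _ Bay) => i; apply: (lincombSl CB); apply: xa.
  by exists i.
have Ayx i : A (fcons y x i).
  case: (unliftP ord0 i) => [j|] ->; rewrite ?fconsS ?fcons0 //.
  by have [l _ <-] := ax j.
have /eqP : fcons (-1) c ord0 = 0; last by rewrite fcons0 oppr_eq0 oner_eq0.
apply: (ldAB _ _ Ayx (free_fcons sC freex nxy)) => [i|].
  case: (unliftP ord0 i) => [j|] ->; rewrite ?fconsS ?fcons0 //.
  by apply: subfieldN => //; exact: subfield1.
rewrite big_ord_recl !fcons0 mulN1r {1}eqy addrC; apply/eqP.
by rewrite subr_eq0; apply/eqP; apply: eq_bigr => i _; rewrite !fconsS.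
Qed.

End SubfieldTheory.

(** * Linear spans of arbitrary sets *)

Section LinearSpan.
Variables (Omega : fieldType).
Implicit Types (A B C S : set Omega).

Inductive lspan C S : Omega -> Prop :=
| lspan0 : lspan C S 0
| lspan_cons c s z : C c -> S s -> lspan C S z -> lspan C S (c * s + z).

Lemma lspanD C S x y : lspan C S x -> lspan C S y -> lspan C S (x + y).
Proof.
move=> Sx Sy; elim: Sx => [|c s z Cc Ss _ IHz]; first by rewrite add0r.
by rewrite -addrA; apply: lspan_cons.
Qed.

Lemma lspanZ C S a x : is_subfield C -> C a -> lspan C S x -> lspan C S (a * x).
Proof.
move=> sC Ca; elim=> [|c s z Cc Ss _ IHz]; first by rewrite mulr0; constructor.
by rewrite mulrDr mulrA; apply: lspan_cons => //; apply: subfieldM.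
Qed.

Lemma mem_lspan C S s : is_subfield C -> S s -> lspan C S s.
Proof.
move=> sC Ss; rewrite -[s]mul1r -[_ * _]addr0; apply: lspan_cons => //.
  exact: subfield1.
exact: lspan0.
Qed.

Lemma lspan_span C S z : lspan C S z ->
  exists n (u : 'I_n -> Omega), (forall i, S (u i)) /\ lincomb C u z.
Proof.
elim=> [|c s {}z Cc Ss _ [n [u [Su [d Cd ->]]]]].
  exists 0%N, (fun=> 0); split=> [[]//|]; exists (fun=> 0) => [[]//|].
  by rewrite big_ord0.
exists n.+1, (fcons s u); split=> [i|].
  by case: (unliftP ord0 i) => [j|] ->; rewrite ?fconsS ?fcons0.
exists (fcons c d) => [i|].
  by case: (unliftP ord0 i) => [j|] ->; rewrite ?fconsS ?fcons0.
rewrite big_ord_recl !fcons0; congr (_ + _).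
by apply: eq_bigr => i _; rewrite !fconsS.
Qed.

Lemma lspan_min C S A : is_subfield A -> C `<=` A -> S `<=` A ->
  lspan C S `<=` A.
Proof.
move=> sA CA SA z; elim=> [|c s {}z /CA Ac /SA As _ Az]; first exact: subfield0.
by apply: subfieldD => //; apply: subfieldM.
Qed.

Lemma lspan_sub_span C S n (u : 'I_n -> Omega) :
  is_subfield C -> S `<=` lincomb C u -> lspan C S `<=` lincomb C u.
Proof.
move=> sC Su z; elim=> [|c s {}z Cc /Su[d Cd ->] _ [e Ce ->]].
  exists (fun=> 0) => [_|]; first exact: subfield0.
  by rewrite big1 // => i _; rewrite mul0r.
exists (fun i => c * d i + e i) => [i|].
  by apply: subfieldD => //; apply: subfieldM.
rewrite mulr_sumr -big_split; apply: eq_bigr => i _ /=.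
by rewrite mulrDl mulrA.
Qed.

Lemma lspanS C D S T : C `<=` D -> S `<=` T -> lspan C S `<=` lspan D T.
Proof.
move=> CD ST z; elim=> [|c s {}z Cc Ss _ IHz]; first exact: lspan0.
by apply: lspan_cons => //; [exact: CD|exact: ST].
Qed.

Lemma lspan_sum C S n (c x : 'I_n -> Omega) : (forall i, C (c i)) ->
  (forall i, S (x i)) -> lspan C S (\sum_i c i * x i).
Proof.
move=> Cc Sx; elim/big_rec: _ => [|i z _ Sz]; first exact: lspan0.
exact: lspan_cons.
Qed.

End LinearSpan.

(** * Adjunction in characteristic p *)

Section Frobenius.
Variables (Omega : fieldType) (p : nat).
Hypothesis charp : p \in [pchar Omega].
Implicit Types (k A B C E F K S : set Omega) (x y : Omega).

Lemma charp_prime : prime p.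
Proof. by case/andP: charp. Qed.

Lemma expp_gt0 n : (0 < p ^ n)%N.
Proof. by rewrite expn_gt0 prime_gt0 // charp_prime. Qed.

Lemma pnat_expp n : [pchar Omega].-nat (p ^ n)%N.
Proof.
by rewrite (eq_pnat _ (pcharf_eq charp)) pnatX pnat_id // charp_prime.
Qed.

Lemma frobD n (x y : Omega) :
  (x + y) ^+ (p ^ n) = x ^+ (p ^ n) + y ^+ (p ^ n).
Proof. by rewrite exprDn_pchar // pnat_expp. Qed.

Lemma frobN n (x : Omega) : (- x) ^+ (p ^ n) = - x ^+ (p ^ n).
Proof. by rewrite exprNn_pchar // pnat_expp. Qed.

Lemma frob0 n : 0 ^+ (p ^ n) = 0 :> Omega.
Proof. by rewrite expr0n eqn0Ngt expp_gt0. Qed.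

Lemma frob_sum n (I : finType) (f : I -> Omega) :
  (\sum_i f i) ^+ (p ^ n) = \sum_i f i ^+ (p ^ n).
Proof.
exact: (big_morph (fun x : Omega => x ^+ (p ^ n)) (frobD n) (frob0 n)).
Qed.

Lemma frobI n : injective (fun x : Omega => x ^+ (p ^ n)).
Proof.
move=> x y /= exy; apply/eqP; rewrite -subr_eq0.
have : (x - y) ^+ (p ^ n) == 0 by rewrite frobD frobN exy subrr.
by rewrite expf_eq0 => /andP[].
Qed.

Lemma frobX m n (x : Omega) : (x ^+ (p ^ m)) ^+ (p ^ n) = x ^+ (p ^ (m + n)).
Proof. by rewrite -exprM -expnD. Qed.

Lemma purely_inseparable_le C x m n : is_subfield C -> (m <= n)%N ->
  C (x ^+ (p ^ m)) -> C (x ^+ (p ^ n)).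
Proof. by move=> sC lemn Cx; rewrite -(subnKC lemn) -frobX; apply: subfieldX. Qed.

Lemma purely_inseparable_lspan k S : is_subfield k ->
  purely_inseparable p k S -> purely_inseparable p k (lspan k S).
Proof.
move=> sk piS z; elim=> [|c s {}z kc Ss _ [n kz]].
  by exists 0%N; rewrite frob0; apply: subfield0.
have [m ks] := piS s Ss; exists (maxn m n).
rewrite frobD exprMn; apply: subfieldD => //.
  apply: subfieldM => //; first exact: subfieldX.
  exact: purely_inseparable_le (leq_maxl _ _) ks.
exact: purely_inseparable_le (leq_maxr _ _) kz.
Qed.

(* The inverse of z is z^(p^n - 1) / z^(p^n), with denominator in k. *)
Lemma adjoin_lspan k S : is_subfield k -> S 1 ->
  (forall x y, S x -> S y -> S (x * y)) -> purely_inseparable p k S ->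
  adjoin k S = lspan k S.
Proof.
move=> sk S1 SM piS; apply/seteqP; split; last first.
  apply: lspan_min; [exact: subfield_adjoin|exact: sub_adjoinl|exact: sub_adjoinr].
have SZ a x : k a -> lspan k S x -> lspan k S (a * x) by exact: lspanZ.
have Sk1 : lspan k S 1 by apply: mem_lspan.
have LM x y : lspan k S x -> lspan k S y -> lspan k S (x * y).
  move=> Lx Ly; elim: Lx => [|c s z kc Ss _ IHz].
    by rewrite mul0r; exact: lspan0.
  rewrite mulrDl; apply: lspanD => //; rewrite -mulrA; apply: SZ => //.
  elim: Ly => [|d t {IHz}z' kd St _ IHz]; first by rewrite mulr0; exact: lspan0.
  rewrite mulrDr mulrCA; apply: lspan_cons => //; exact: SM.
have LX x n : lspan k S x -> lspan k S (x ^+ n).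
  by move=> Lx; elim: n => [|n IHn]; rewrite ?expr0 // exprS; apply: LM.
apply: adjoin_min; last by move=> x Sx; apply: mem_lspan.
  apply/is_subfieldP; split=> // x y Lx Ly.
    apply: lspanD => //; rewrite -mulN1r; apply: SZ => //.
    by apply: subfieldN => //; exact: subfield1.
  apply: LM => //; have [->|y0] := eqVneq y 0; first by rewrite invr0; exact: lspan0.
  have [n ky] := purely_inseparable_lspan sk piS Ly.
  have -> : y^-1 = (y ^+ (p ^ n))^-1 * y ^+ (p ^ n).-1.
    apply: (mulfI y0); rewrite divff // mulrCA -exprS prednK ?expp_gt0 //.
    by rewrite mulVf // expf_neq0.
  apply: SZ; last exact: LX.
  by rewrite -[_^-1]mul1r; apply: subfield_div => //; exact: subfield1.
by move=> x kx; rewrite -[x]mulr1; apply: SZ.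
Qed.

Lemma adjoin1_lspan F x n : is_subfield F -> F (x ^+ (p ^ n)) ->
  adjoin F [set x] `<=` lincomb F (fun i : 'I_(p ^ n) => x ^+ i).
Proof.
move=> sF Fx; apply: (@subset_trans _ (adjoin F (range (fun i => x ^+ i)))).
  by apply: adjoinS => // _ ->; exists 1%N.
rewrite adjoin_lspan //; last first.
- move=> _ [i _ <-]; exists n; rewrite -exprM mulnC exprM.
  exact: subfieldX.
- by move=> _ _ [i _ <-] [j _ <-]; exists (i + j)%N => //; rewrite exprD.
- by exists 0%N.
apply: lspan_sub_span => // _ [i _ <-].
(* Division of i by p^n: the quotient contributes a power of x^(p^n), a scalar in [F], and the
   remainder selects the spanning power. *)
have ltm : (i %% p ^ n < p ^ n)%N by rewrite ltn_mod expp_gt0.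
exists (fun j : 'I_(p ^ n) => if j == Ordinal ltm
   then (x ^+ (p ^ n)) ^+ (i %/ p ^ n) else 0) => [j|].
  by case: eqP => _; [exact: subfieldX|exact: subfield0].
rewrite (bigD1 (Ordinal ltm)) //= eqxx big1 ?addr0 => [|j /negPf->].
  by rewrite -exprM -exprD mulnC -divn_eq.
by rewrite mul0r.
Qed.

(* A polynomial over E of minimal size vanishing at x divides
   X^(p^n) - x^(p^n) = (X - x)^(p^n), so it is a power of X - x, and its
   constant term puts a proper p-power of x into E. *)
Lemma exprp_free E x n : is_subfield E -> E (x ^+ (p ^ n.+1)) ->
  ~ E (x ^+ (p ^ n)) -> free_over E (fun i : 'I_(p ^ n.+1) => x ^+ i).
Proof.
move=> sE Ex nEx c Ec eqc i; apply/eqP/negPn/negP => ci.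

pose Q m := `[< exists P : {poly Omega}, [/\ forall j, E P`_j, P != 0, root P x
    & size P = m] >].
pose P0 := \poly_(j < p ^ n.+1) (if insub j is Some l then c l else 0).
have P0E (j : 'I_(p ^ n.+1)) : P0`_j = c j.
  by rewrite coef_poly ltn_ord valK.
have QP0 : Q (size P0).
  apply/asboolP; exists P0; split=> //.
  - move=> j; rewrite coef_poly; case: ifP => [ltj|_]; last exact: subfield0.
    by rewrite insubT.
  - by apply: contraNneq ci => P00; rewrite -P0E P00 coef0.
  - rewrite rootE horner_poly -[X in _ == X]eqc; apply/eqP; apply: eq_bigr => j _.
    by rewrite valK.
case: (ex_minnP (ex_intro Q _ QP0)) => m /asboolP[P [PE' P0' rP sP]] minm.
have mlt : (m <= p ^ n.+1)%N by apply: leq_trans (minm _ QP0) (size_poly _ _).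
(* Division by the minimal [P]: cancelling leading terms keeps the coefficients in [E] and the root
   [x]. *)
have divP (R : {poly Omega}) : (forall j, E R`_j) -> root R x -> P %| R.
  have [N] := ubnP (size R); elim: N R => // N IHN R ltR ER rR.
  have [->|R0] := eqVneq R 0; first exact: dvdp0.
  have leP : (size P <= size R)%N.
    by rewrite sP; apply: minm; apply/asboolP; exists R.
  pose a := lead_coef R / lead_coef P.
  pose D := a *: 'X^(size R - size P) * P.
  have Ea : E a by apply: subfield_div => //; rewrite lead_coefE.
  have lP0 : lead_coef P != 0 by rewrite lead_coef_eq0.
  have a0 : a != 0 by rewrite mulf_neq0 ?invr_eq0 // lead_coef_eq0.
  suff : P %| R - D by rewrite dvdp_subl // dvdp_mull.
  apply: IHN.
  - have sD : size D = size R.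
      rewrite /D -scalerAl size_scale // mulrC size_mulXn //.
      by rewrite subnK.
    have lD : lead_coef D = lead_coef R.
      by rewrite /D -scalerAl lead_coefZ lead_coefM lead_coefXn mul1r divfK.
    have lt1 : (size (R - D)%R < size R)%N.
      have sR : size R = (size R).-1.+1 by rewrite prednK // size_poly_gt0.
      rewrite [X in (_ < X)%N]sR ltnS.
      apply/leq_sizeP => j lej; rewrite coefB.
      have [ltj|gtj|<-] := ltngtP (size R).-1 j.
      + by rewrite !nth_default ?subrr // ?sD; case: (size R) ltj.
      + by move: gtj; rewrite ltnNge lej.
      + by rewrite -{2}sD -!lead_coefE lD subrr.
    exact: leq_trans lt1 _.
  - move=> j; rewrite coefB; apply: subfieldD => //; apply: subfieldN => //.
    rewrite /D -scalerAl coefZ coefXnM; apply: subfieldM => //.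
    by case: ifP => _ //; apply: subfield0.
  - by rewrite rootE hornerD hornerN hornerM (eqP rR) (eqP rP) mulr0 subrr.
have XpE : 'X^(p ^ n.+1) - (x ^+ (p ^ n.+1))%:P = ('X - x%:P) ^+ (p ^ n.+1).
  have chX : p \in [pchar {poly Omega}] by rewrite pchar_poly.
  rewrite exprDn_pchar ?(eq_pnat _ (pcharf_eq chX)) ?pnatX ?pnat_id ?charp_prime //.
  rewrite exprNn_pchar ?(eq_pnat _ (pcharf_eq chX)) ?pnatX ?pnat_id ?charp_prime //.
  by rewrite polyC_exp.
have /dvdp_exp_XsubCP[l lel eqP] : P %| ('X - x%:P) ^+ (p ^ n.+1).
  rewrite -XpE; apply: divP => [j|].
    rewrite coefB coefXn coefC; apply: subfieldD => //.
      by case: eqP => _; [exact: subfield1|exact: subfield0].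
    apply: subfieldN => //; case: eqP => _ //; exact: subfield0.
  by rewrite rootE !hornerE subrr.
have sl : m = l.+1 by rewrite -sP (eqp_size eqP) size_exp_XsubC.
have ltl : (l < p ^ n.+1)%N by rewrite -sl.
have l0 : (0 < l)%N.
  by case: l eqP {lel ltl sl} => // /eqp_root/(_ x); rewrite expr0 rP (negPf (root1 x)).
have Exl : E (x ^+ l).
  have [a [a0 eqa]] : exists a, a != 0 /\ P = a *: ('X - x%:P) ^+ l.
    have /eqpP[[a b] /= /andP[a0 b0] ab] := eqP.
    exists (a^-1 * b); split; first by rewrite mulf_neq0 ?invr_eq0.
    by rewrite -scalerA -ab scalerA mulVf // scale1r.
  have EaL : E a.
    have -> : a = lead_coef P.
      by rewrite eqa lead_coefZ lead_coef_exp lead_coefXsubC expr1n mulr1.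
    by rewrite lead_coefE.
  have : E (P`_0) by [].
  rewrite -horner_coef0 eqa hornerZ horner_exp hornerXsubC sub0r => EaxN.
  have := subfield_div sE EaxN EaL; rewrite mulrAC divff // mul1r.
  move=> EaxS; rewrite -[x]opprK exprNn; apply: subfieldM => //.
  by apply: subfieldX => //; apply: subfieldN => //; exact: subfield1.
(* Bezout: x^l and x^(p^(n+1)) lie in [E], hence so does the power of [x] at their gcd, which is p^s
   with s <= n because 0 < l < p^(n+1). *)
have Eg : E (x ^+ gcdn l (p ^ n.+1)).
  have x0 : x != 0 by apply: contra_not_neq nEx => ->; rewrite frob0; exact: subfield0.
  have [u v eg _] := egcdnP (p ^ n.+1) l0.
  have -> : x ^+ gcdn l (p ^ n.+1) = (x ^+ l) ^+ u / (x ^+ (p ^ n.+1)) ^+ v.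
    rewrite -!exprM [(l * u)%N]mulnC eg addnC exprD [(_ * v)%N]mulnC mulfK //.
    by rewrite expf_neq0.
  by apply: subfield_div => //; apply: subfieldX.
have /(dvdn_pfactor _ _ charp_prime)[s les es] := dvdn_gcdr l (p ^ n.+1).
have les' : (s <= n)%N.
  rewrite -ltnS ltn_neqAle les andbT; apply: contraTneq ltl => eqs.
  by rewrite -leqNgt -eqs -es; apply: dvdn_leq => //; apply: dvdn_gcdl.
by apply: nEx; rewrite es in Eg; apply: purely_inseparable_le les' Eg.
Qed.

(** The powers of [x] are free even over F(y), so an expression of [y] as their combination over [F]
    reduces to its constant term and would put [y] in [F]. *)
Lemma adjoin1_exchange F x y n : is_subfield F -> F (x ^+ (p ^ n.+1)) -> ~ F y ->
  ~ adjoin F [set y] (x ^+ (p ^ n)) -> ~ adjoin F [set x] y.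
Proof.
move=> sF Fx nFy nx /(adjoin1_lspan sF Fx)[c Fc eqy].
have sFy : is_subfield (adjoin F [set y]) by exact: subfield_adjoin.
have FFy : F `<=` adjoin F [set y] by exact: sub_adjoinl.
pose i0 : 'I_(p ^ n.+1) := Ordinal (expp_gt0 n.+1).
pose d i := c i - (i == i0)%:R * y.
have d0 : d i0 = 0.
  apply: (exprp_free sFy (FFy _ Fx) nx) => [i|].
    apply: (subfieldD sFy); first exact: FFy.
    apply: (subfieldN sFy); apply: (subfieldM sFy); last exact: sub_adjoinr.
    by case: eqP => _; [exact: subfield1|exact: subfield0].
  under eq_bigr do rewrite mulrBl.
  rewrite sumrB -eqy (bigD1 i0) //= ?eqxx mul1r expr0 mulr1 big1 ?addr0 ?subrr //.
  by move=> i /negPf->; rewrite !mul0r.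
by apply: nFy; move/subr0_eq: d0; rewrite eqxx mul1r => <-.
Qed.

End Frobenius.

(** * The layers of a purely inseparable extension *)

Definition kfrob (Omega : fieldType) (p : nat) (k : set Omega) i A :=
  adjoin k (frob_image p i A).

(** The field K_n of the overview; taken over [m] instead of [k] it is M_n. *)
Definition layer (Omega : fieldType) (p : nat) (k K : set Omega) n :=
  frob_preimage p n k `&` K.

Section Layers.
Variables (Omega : fieldType) (p : nat).
Hypothesis charp : p \in [pchar Omega].
Implicit Types (k m A B K L : set Omega).

Lemma subfield_frob_preimage n k :
  is_subfield k -> is_subfield (frob_preimage p n k).
Proof.
move=> sk; apply/is_subfieldP; rewrite /frob_preimage; split=> /=.
- by rewrite expr1n; apply: subfield1.
- move=> x y kx ky; rewrite (frobD charp) (frobN charp); apply: subfieldD => //.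
  exact: subfieldN.
- by move=> x y kx ky; rewrite exprMn exprVn; apply: subfield_div.
Qed.

Lemma subfield_kfrob k i A : is_subfield (kfrob p k i A).
Proof. exact: subfield_adjoin. Qed.

Lemma sub_kfrob k i A : k `<=` kfrob p k i A.
Proof. exact: sub_adjoinl. Qed.

Lemma frob_kfrob k i A x : A x -> kfrob p k i A (x ^+ (p ^ i)).
Proof. by move=> Ax; apply: sub_adjoinr; exists x. Qed.

Lemma kfrobS k m i A B : k `<=` m -> A `<=` B -> kfrob p k i A `<=` kfrob p m i B.
Proof. by move=> km AB; apply: adjoinS => // _ [x /AB Bx <-]; exists x. Qed.

Lemma kfrob_min k i A B : is_subfield B -> k `<=` B ->
  (forall x, A x -> B (x ^+ (p ^ i))) -> kfrob p k i A `<=` B.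
Proof. by move=> sB kB AB; apply: adjoin_min => // _ [x /AB Bx <-]. Qed.

Lemma kfrob_sub k i A : is_subfield A -> k `<=` A -> kfrob p k i A `<=` A.
Proof. by move=> sA kA; apply: kfrob_min => // x Ax; apply: subfieldX. Qed.

Lemma kfrob0 k A : is_subfield A -> k `<=` A -> kfrob p k 0 A = A.
Proof.
move=> sA kA; apply/seteqP; split; first exact: kfrob_sub.
by move=> x Ax; have := @frob_kfrob k 0 A x Ax; rewrite expr1.
Qed.

Lemma kfrobD k i j A : is_subfield k ->
  kfrob p k i (kfrob p k j A) = kfrob p k (j + i) A.
Proof.
move=> sk; apply/seteqP; split.
  apply: kfrob_min; [exact: subfield_kfrob|exact: sub_kfrob|move=> x].
  (* The elements whose p^i-th power lies in the target form a field, so only generators need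
     checking. *)
  apply: (@kfrob_min _ _ _ (frob_preimage p i (kfrob p k (j + i) A))).
  - by apply: subfield_frob_preimage; apply: subfield_kfrob.
  - by move=> y ky; apply: sub_kfrob; apply: subfieldX.
  - by move=> y Ay; rewrite /frob_preimage /= frobX; apply: frob_kfrob.
apply: kfrob_min; [exact: subfield_kfrob|exact: sub_kfrob|move=> x Ax].
by rewrite -frobX; do 2 apply: frob_kfrob.
Qed.

Lemma kfrob_lspan k i A : is_subfield k -> is_subfield A ->
  purely_inseparable p k A -> kfrob p k i A = lspan k (frob_image p i A).
Proof.
move=> sk sA piA; apply: (adjoin_lspan charp) => //.
- by exists 1; [exact: subfield1|rewrite expr1n].
- move=> _ _ [x Ax <-] [y Ay <-]; exists (x * y); first exact: subfieldM.
  by rewrite exprMn.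
- move=> _ [x Ax <-]; have [n kx] := piA x Ax; exists n.
  by rewrite frobX addnC -frobX; apply: subfieldX.
Qed.

(** Frobenius is additive, so it carries combinations over [B] to combinations over k(B^(p^i)).
    Hence degrees do not grow when A/B is replaced by k(A^(p^i))/k(B^(p^i)). *)
Lemma kfrob_lincomb k i A B n (u : 'I_n -> Omega) :
  is_subfield k -> is_subfield A -> purely_inseparable p k A ->
  A `<=` lincomb B u ->
  kfrob p k i A `<=` lincomb (kfrob p k i B) (fun j => u j ^+ (p ^ i)).
Proof.
move=> sk sA piA Au; rewrite kfrob_lspan //.
apply: (@subset_trans _ (lspan (kfrob p k i B) (frob_image p i A))).
  by apply: lspanS => //; exact: sub_kfrob.
apply: lspan_sub_span; first exact: subfield_kfrob.
move=> _ [x /Au[c Bc ->] <-]; exists (fun j => c j ^+ (p ^ i)) => [j|].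
  by apply: frob_kfrob.
by rewrite (frob_sum charp); apply: eq_bigr => j _; rewrite exprMn.
Qed.

Lemma kfrob_fin_span k i A B n :
  is_subfield k -> is_subfield A -> purely_inseparable p k A ->
  fin_span B A n -> fin_span (kfrob p k i B) (kfrob p k i A) n.
Proof.
move=> sk sA piA [u Au]; exists (fun j => u j ^+ (p ^ i)).
exact: kfrob_lincomb.
Qed.

Variables (k K : set Omega).
Hypotheses (sk : is_subfield k) (sK : is_subfield K) (kK : k `<=` K).
Local Notation layer := (layer p k K).

Lemma subfield_layer n : is_subfield (layer n).
Proof. by apply: subfieldI => //; apply: subfield_frob_preimage. Qed.

Lemma sub_layer n : k `<=` layer n.
Proof. by move=> x kx; split; [apply: subfieldX|apply: kK]. Qed.

Lemma layer_sub n : layer n `<=` K.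
Proof. by move=> x []. Qed.

Lemma layer_insep n : purely_inseparable p k (layer n).
Proof. by move=> x [kx _]; exists n. Qed.

Lemma layerS a b : (a <= b)%N -> layer a `<=` layer b.
Proof.
by move=> leab x [kx Kx]; split=> //; apply: (purely_inseparable_le sk leab).
Qed.

Lemma layer0 : layer 0 = k.
Proof.
apply/seteqP; split; last exact: sub_layer.
by move=> x [+ _]; rewrite /frob_preimage /= expr1.
Qed.

Lemma frob_layer i n x : layer (n + i) x -> layer n (x ^+ (p ^ i)).
Proof.
move=> [kx Kx]; split; last exact: subfieldX.
by rewrite /frob_preimage /= frobX addnC.
Qed.

Lemma kfrob_layer i n : kfrob p k i (layer (n + i)) `<=` layer n.
Proof.
apply: kfrob_min; [exact: subfield_layer|exact: sub_layer|].
by move=> x; apply: frob_layer.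
Qed.

Lemma kfrob_layer_same n : kfrob p k n (layer n) = k.
Proof.
apply/seteqP; split; last exact: sub_kfrob.
by rewrite -{3}layer0; apply: (@kfrob_layer n 0).
Qed.

Hypothesis K_insep : purely_inseparable p k K.

Hypothesis K_unbounded : unbounded_exponent p k K.

(** If K_(n+1) = K_n, the layers stop growing: for x in K_(n+j+1), x^(p^j) lies in K_(n+1) = K_n, so
    x lies in K_(n+j). Then K would have exponent at most n. *)
Lemma layer_strict n : exists2 x, layer n.+1 x & ~ k (x ^+ (p ^ n)).
Proof.
apply: contrapT => noX; apply: K_unbounded; exists n.
have lay x : layer n.+1 x -> layer n x.
  move=> lx; split; last exact: layer_sub lx.
  by apply: contrapT => nkx; apply: noX; exists x.
have all_lay j x : layer (n + j) x -> layer n x.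
  elim: j => [|j IHj]; first by rewrite addn0.
  move=> lx; apply: IHj; split; last exact: layer_sub lx.
  rewrite /frob_preimage /= addnC -frobX.
  by have [] := lay _ (@frob_layer j n.+1 x _); rewrite // addSn -addnS.
move=> _ [x Kx <-]; have [e kx] := K_insep Kx.
have lx : layer (n + e) x by apply: (@layerS e); [exact: leq_addl|split].
by have [] := all_lay e x lx.
Qed.

End Layers.

(** * A modular extension from bounded r-bases *)

Lemma bounded_nondecreasing_stationary (D : nat -> nat) q :
  (forall g, (D g <= D g.+1)%N) -> (forall g, (D g <= q)%N) ->
  exists g0, forall g, (g0 <= g)%N -> D g = D g0.
Proof.
move=> Dle Dq.
have leD a b : (a <= b)%N -> (D a <= D b)%N.
  by move=> /subnK <-; elim: (b - a)%N => // l IHl; apply: leq_trans (Dle _).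
pose P n := `[< exists g, D g = n >].
have exP : exists n, P n by exists (D 0%N); apply/asboolP; exists 0%N.
have leP n : P n -> (n <= q)%N by move=> /asboolP[g <-].
case: (ex_maxnP exP leP) => n /asboolP[g0 eg0] maxn; exists g0 => g leg.
apply/eqP; rewrite eqn_leq [X in _ && X]leD // andbT eg0.
by apply: maxn; apply/asboolP; exists g.
Qed.

Section ModularSubfield.
Variables (Omega : fieldType) (p : nat).
Hypothesis charp : p \in [pchar Omega].
Variables (k K : set Omega).
Hypotheses (sk : is_subfield k) (sK : is_subfield K) (kK : k `<=` K).
Hypotheses (K_insep : purely_inseparable p k K).
Local Notation layer := (layer p k K).
Local Notation kfrob := (kfrob p k).

Variable q : nat.
Hypothesis layer_q : forall n, fin_span (kfrob 1 (layer n)) (layer n) q.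

Let s_layer n : is_subfield (layer n).
Proof. exact: subfield_layer. Qed.

Lemma kfrob_layer_fin_span n i :
  fin_span (kfrob i.+1 (layer n)) (kfrob i (layer n)) q.
Proof.
rewrite -add1n -(kfrobD charp) //.
by apply: (kfrob_fin_span charp) => //; apply: layer_insep.
Qed.

(** The chain of the k(K_n^(p^i)) descends from K_n to [k], reached at i = n, in steps of degree at
    most [q]. *)
Lemma layer_finite n : exists N, fin_span k (layer n) N.
Proof.
suff H i : exists N, fin_span (kfrob i (layer n)) (layer n) N.
  by have [N] := H n; rewrite kfrob_layer_same //; exists N.
elim: i => [|i [N fN]]; last first.
  by exists (N * q)%N; apply: fin_span_tower fN _; apply: kfrob_layer_fin_span.
exists 1%N; rewrite kfrob0 //; last exact: sub_layer.
exact: basis_fin_span (has_basis_self _).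
Qed.

Let tow g t := kfrob t (layer (g + t)).

Let tow_sub_layer g t : tow g t `<=` layer g.
Proof. exact: kfrob_layer. Qed.

Let tow_dec g s t : (s <= t)%N -> tow g t `<=` tow g s.
Proof.
move=> /subnK <-; elim: (t - s)%N => // j IHj; apply: subset_trans IHj.
rewrite /tow addSn -add1n -(kfrobD charp) //; apply: kfrobS => //.
by rewrite addnCA addnC; apply: kfrob_layer.
Qed.

Let tow_inc g t : tow g t `<=` tow g.+1 t.
Proof. by apply: kfrobS => //; apply: layerS => //; rewrite leq_add2r. Qed.

(* The field B_g of the header. *)
Definition perfect_core g : set Omega := \bigcap_t kfrob t (layer (g + t)).
Local Notation core := perfect_core.

(** The chain descends inside K_g, which is finite over [k], so its intersection is attained from
    some index on. *)
Lemma perfect_core_tower g :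
  exists T, forall t, (T <= t)%N -> core g = kfrob t (layer (g + t)).
Proof.
have [N fN] := layer_finite g.
have [||||T HT] := @descending_stationary _ k (tow g) N sk.
- by move=> t; apply: subfield_kfrob.
- by move=> t; apply: sub_kfrob.
- by move=> s t; apply: tow_dec.
- by apply: sub_fin_span fN; apply: tow_sub_layer.
exists T => t leTt; rewrite -[RHS]/(tow g t) HT //.
apply/seteqP; split=> [x|x Tx s _]; first exact.
have [lesT|/ltnW leTs] := leqP s T; first exact: tow_dec Tx.
by rewrite -/(tow g s) HT.
Qed.

Lemma subfield_core g : is_subfield (core g).
Proof.
by have [T HT] := perfect_core_tower g; rewrite (HT T) //; apply: subfield_kfrob.
Qed.

Lemma sub_core g : k `<=` core g.
Proof. by move=> x kx t _; apply: sub_kfrob. Qed.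

Lemma core_sub_layer g : core g `<=` layer g.
Proof. by move=> x /(_ 0%N I); apply: tow_sub_layer. Qed.

Lemma core_insep g : purely_inseparable p k (core g).
Proof. by move=> x /core_sub_layer; apply: layer_insep. Qed.

Lemma core_incr g : core g `<=` core g.+1.
Proof. by move=> x cx t _; apply: tow_inc; apply: cx. Qed.

Lemma coreS a b : (a <= b)%N -> core a `<=` core b.
Proof.
move=> /subnK <-; elim: (b - a)%N => // l IHl.
exact: subset_trans IHl (@core_incr _).
Qed.

(** For large t, B_(g+1) = k(L^(p^t)) and B_g = k(L^(p^(t+1))) with the same layer L = K_(g+1+t). *)
Lemma kfrob_core1 g : kfrob 1 (core g.+1) = core g.
Proof.
have [T HT] := perfect_core_tower g; have [U HU] := perfect_core_tower g.+1.
rewrite (HU (maxn T U)) ?leq_maxr // (kfrobD charp) // addn1 addSnnS -HT //.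
by rewrite leqW // leq_maxl.
Qed.

Lemma kfrob_core i g : kfrob i (core (g + i)) = core g.
Proof.
elim: i => [|i IHi]; first by rewrite addn0 kfrob0 //; [exact: subfield_core|exact: sub_core].
by rewrite -[RHS]IHi -(kfrob_core1 (g + i)) (kfrobD charp) // add1n addnS.
Qed.

Lemma core_fin_span g : fin_span (core g) (core g.+1) q.
Proof.
have [T HT] := perfect_core_tower g; have [U HU] := perfect_core_tower g.+1.
rewrite (HU (maxn T U)) ?leq_maxr // (HT (maxn T U).+1); last first.
  by rewrite leqW // leq_maxl.
by rewrite addSnnS; apply: kfrob_layer_fin_span.
Qed.

Hypothesis K_unbounded : unbounded_exponent p k K.

(** Some x in K_(g+1+T) has exponent exactly g+1+T; then x^(p^T) lies in B_(g+1) and has exponent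
    g+1. *)
Lemma core_strict g : exists2 x, core g.+1 x & ~ k (x ^+ (p ^ g)).
Proof.
have [T HT] := perfect_core_tower g.+1.
have [x lx nkx] := layer_strict sk sK K_insep K_unbounded (g + T).
exists (x ^+ (p ^ T)); last by rewrite frobX addnC.
by rewrite (HT T) //; apply: frob_kfrob; rewrite addSn.
Qed.

Hypothesis K_w0 : w0_generated p k K.

Lemma w0_generated_eq L :
  intermediate_field k K L -> unbounded_exponent p k L -> L = K.
Proof. by move=> iL uL; apply: contrapT => nLK; apply: K_w0; exists L. Qed.

Lemma bigcup_core : \bigcup_g core g = K.
Proof.
apply: w0_generated_eq.
  split; first by apply: subfield_bigcup; [exact: subfield_core|exact: coreS].
    by move=> x kx; exists 0%N => //; apply: sub_core.
  by move=> x [g _ /core_sub_layer/layer_sub].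
case=> e He; have [x cx nkx] := core_strict e.
by apply/nkx/He; exists x => //; exists e.+1.
Qed.

Lemma modular_subfield : exists m,
  [/\ intermediate_field k K m, modular p m K & m <> K].
Proof.
have /choice[D bD] g : exists D, has_basis (core g) (core g.+1) D.
  have [r _ br] := fin_span_has_basis (subfield_core g) (core_fin_span g).
  by exists r.
(* Frobenius turns a basis of B_(g+2) over B_(g+1) into a spanning family of B_(g+1) over B_g. *)
have DS g : (D g <= D g.+1)%N.
  apply: basis_leq (subfield_core g) (bD g) _.
  have := kfrob_fin_span charp 1 sk (subfield_core _) (@core_insep _)
    (basis_fin_span (bD g.+1)).
  by rewrite !kfrob_core1.
have Dq g : (D g <= q)%N.
  exact: basis_leq (subfield_core g) (bD g) (core_fin_span g).
have [g0 Dg0] := bounded_nondecreasing_stationary DS Dq.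
have deg g j : (g0 <= g)%N -> has_basis (core g) (core (g + j)) (D g0 ^ j).
  move=> leg; elim: j => [|j IHj].
    by rewrite addn0; apply: has_basis_self; apply: subfield_core.
  rewrite addnS expnS; apply: has_basis_tower IHj; try exact: subfield_core.
  - by apply: coreS; apply: leq_addr.
  - exact: core_incr.
  - by rewrite -(Dg0 (g + j)%N) // (leq_trans leg) ?leq_addr.
set m := core g0; exists m.
have sm : is_subfield m by exact: subfield_core.
have mK : m `<=` K by move=> x /core_sub_layer/layer_sub.
have km : k `<=` m by exact: sub_core.
split=> //; last first.
  (* [m] has exponent at most g0, while B_(g0+1) has an element of larger exponent. *)
  move=> eqm; have [x cx nkx] := core_strict g0; apply: nkx.
  have : m x by rewrite eqm; have [] := core_sub_layer cx.
  by move=> /core_sub_layer[].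
move=> n; have sKn := subfield_frob_image n charp sK.
apply: linearly_disjoint_sym => //; first exact: subfieldI.
move=> r a ma freea x Kx eqx i.
have /choice[z zP] l : exists z, K z /\ z ^+ (p ^ n) = x l.
  by have [z Kz <-] := Kx l; exists z.
have /choice[e eP] l : exists e, core e (z l).
  by have := (zP l).1; rewrite -bigcup_core => -[e _ ce]; exists e.
(* One index serves for all the roots [z l], so that they expand in a common basis [h] over
   B_(g0+n). *)
pose N := (\max_l e l)%N.
have czN l : core (g0 + n + N) (z l).
  by apply: (coreS (leq_trans (@leq_bigmax _ e l) (leq_addl _ _))); apply: eP.
have [h [hc _ hspan]] := deg (g0 + n)%N N (leq_addr _ _).
(* The h_j^(p^n) span B_(g0+N) over [m], and their number is its degree, so they are free. *)
have freeh : free_over m (fun j => h j ^+ (p ^ n)).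
  apply: (span_basis_free sm (deg g0 N (leqnn _))).
  have := kfrob_lincomb charp (i := n) sk (subfield_core _) (@core_insep _) hspan.
  by rewrite addnAC !kfrob_core.
have /choice[c cP] l : exists c : 'I_(D g0 ^ N) -> Omega,
    (forall j, core (g0 + n) (c j)) /\ z l = \sum_j c j * h j.
  by have [c Cc ->] := hspan _ (czN l); exists c.
have mc l j : m (c l j ^+ (p ^ n)).
  by rewrite /m -(kfrob_core n g0); apply: frob_kfrob; apply: (cP l).1.
have xE l : x l = \sum_j c l j ^+ (p ^ n) * h j ^+ (p ^ n).
  rewrite -(zP l).2 (cP l).2 (frob_sum charp).
  by apply: eq_bigr => j _; rewrite exprMn.
(* The coefficient of the relation along h_j^(p^n) is itself a relation among the [a l], with
   scalars in both K^(p^n) and [m]. *)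
have coef0 j : \sum_l c l j ^+ (p ^ n) * a l = 0.
  apply: (freeh (fun j => \sum_l c l j ^+ (p ^ n) * a l)) => [j'|].
    by apply: (subfield_sum sm) => l; apply: (subfieldM sm); [exact: mc|exact: ma].
  under eq_bigr => j' _ do rewrite mulr_suml.
  rewrite exchange_big -[RHS]eqx; apply: eq_bigr => l _ /=.
  by rewrite xE mulr_suml; apply: eq_bigr => j' _; rewrite mulrAC.
rewrite xE big1 // => j _.
rewrite (freea (fun l => c l j ^+ (p ^ n)) _ (coef0 j)) ?mul0r // => l.
split; last exact: mc.
have [_ Kc] := core_sub_layer ((cP l).1 j).
by exists (c l j).
Qed.

End ModularSubfield.

(** * Existence of r-bases *)

Section RBasis.
Variables (Omega : fieldType) (p : nat).
Hypothesis charp : p \in [pchar Omega].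
Implicit Types (k A B C K L : set Omega).

(** Zorn gives a maximal independent set; by the exchange lemma, an element it fails to generate
    could be added to it. *)
Lemma r_basis_exists k L : is_subfield L -> k `<=` L -> exists B, r_basis p k L B.
Proof.
move=> sL kL; set C := adjoin k (frob_image p 1 L).
have CL : C `<=` L by exact: kfrob_sub.
have sC : is_subfield C by exact: subfield_adjoin.
pose P B := B `<=` L /\ forall x, B x -> ~ adjoin C (B `\ x) x.
have [F FP totF|A [[AL indA] maxA]] := @Zorn_bigcup _ P.
  split=> [x [X FX Xx]|x [X0 FX0 X0x] Ux]; first by have [+ _] := FP X FX; apply.
  (* The union of the fields generated over [C] by X minus [x], for X in the chain above [X0]: a
     field containing [C] and the whole union minus [x]. *)
  pose W := [set z | exists X, [/\ F X, X0 `<=` X & adjoin C (X `\ x) z]].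
  suff [X [FX X0X]] : W x by have [_ indX] := FP X FX; apply/indX/X0X.
  have joinW X Y : F X -> F Y -> exists Z, [/\ F Z, X `<=` Z & Y `<=` Z].
    by move=> FX FY; have [XY|YX] := totF X Y FX FY; [exists Y|exists X]; split.
  have W2 (op : Omega -> Omega -> Omega) :
      (forall E, is_subfield E -> forall y z, E y -> E z -> E (op y z)) ->
      forall y z, W y -> W z -> W (op y z).
    move=> opE y z [X [FX X0X Xy]] [Y [FY Y0Y Yz]].
    have [Z [FZ XZ YZ]] := joinW X Y FX FY; exists Z; split=> //.
      exact: subset_trans X0X XZ.
    apply: (opE (adjoin C (Z `\ x)) (subfield_adjoin _ _)).
    - by apply: adjoinS Xy => // w [? ?]; split=> //; apply: XZ.
    - by apply: adjoinS Yz => // w [? ?]; split=> //; apply: YZ.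
  have CW : C `<=` W by move=> z Cz; exists X0; split=> //; apply: sub_adjoinl.
  have sW : is_subfield W.
    apply/is_subfieldP; split; first by apply: CW; apply: subfield1.
      by apply: W2 => E /is_subfieldP[].
    by apply: W2 => E /is_subfieldP[].
  apply: (adjoin_min sW CW _ Ux) => z [[X FX Xz] zx].
  have [Z [FZ XZ X0Z]] := joinW X X0 FX FX0; exists Z; split=> //.
  by apply: sub_adjoinr; split=> //; apply: XZ.
exists A; split=> //; apply/seteqP; split; last exact: adjoin_min.
move=> x Lx; apply: contrapT => nx; rewrite -/C in nx.
apply: (maxA (A `|` [set x])).
  split; first by move=> y; left.
  by move=> /(_ x (or_intror erefl)) Ax; apply: nx; apply: sub_adjoinr.
split=> [y [/AL//|->//]|b bA].
have [->|nbx] := pselect (b = x).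
  apply: contra_not nx; apply: adjoinS => // y [[Ay|->] yx] //; by case: yx.
(* Exchange over E = C(A minus b): x^p lies in [E], b is not in [E], and x is not in E(b), so b is
   not in E(x). *)
case: bA => // Ab; set E := adjoin C (A `\ b).
have sE : is_subfield E by exact: subfield_adjoin.
have EU S : adjoin E S = adjoin C (A `\ b `|` S) by rewrite adjoin_setU.
have Ex : E (x ^+ (p ^ 1)).
  by apply: sub_adjoinl; apply: sub_adjoinr; exists x.
suff nEb : ~ adjoin E [set x] b.
  apply: contra_not nEb; rewrite EU; apply: adjoinS => //.
  by move=> y [[Ay|->] yb]; [left|right].
apply: (adjoin1_exchange charp sE Ex); first exact: indA.
rewrite expr1; apply: contra_not nx; rewrite EU; apply: adjoinS => //.
by move=> y [[]|->].
Qed.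

Lemma adjoin_fin_span C (f : nat -> Omega) d : is_subfield C ->
  (forall i, (i < d)%N -> C (f i ^+ p)) ->
  fin_span C (adjoin C (f @` `I_d)) (p ^ d).
Proof.
move=> sC; elim: d => [|d IHd] Cf.
  apply: sub_fin_span (basis_fin_span (has_basis_self sC)).
  by apply: adjoin_min => // x [i].
have -> : adjoin C (f @` `I_d.+1) = adjoin (adjoin C (f @` `I_d)) [set f d].
  rewrite -adjoin_setU; congr adjoin; apply/seteqP; split.
    move=> y [i /= ltid <-]; move: ltid; rewrite ltnS leq_eqVlt => /orP[/eqP->|ltid]; first by right.
    by left; exists i.
  by move=> _ [[i /= ltid <-]|->]; [exists i => //; apply: leqW|exists d => /=].
rewrite expnS; apply: fin_span_tower (IHd _); last first.
  by move=> i ltid; apply: Cf; apply: leqW.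
exists (fun i => f d ^+ i).
have := @adjoin1_lspan _ _ charp (adjoin C (f @` `I_d)) (f d) 1.
rewrite expn1; apply; first exact: subfield_adjoin.
by apply: sub_adjoinl; apply: Cf.
Qed.

Lemma r_basis_fin_span k L B d : is_subfield L -> k `<=` L ->
  r_basis p k L B -> B #<= `I_d ->
  fin_span (kfrob p k 1 L) L (p ^ d).
Proof.
move=> sL kL [BL eqL _] Bd; rewrite {2}eqL.
have [f [fB Bf]] : exists f : nat -> Omega,
    B `<=` f @` `I_d /\ forall i, (i < d)%N -> L (f i).
  (* Either [B] is empty, where the constant 0 serves, or [I_d] maps onto it. *)
  have [->|[f]] := elimT pfcard_geP Bd.
    by exists (fun=> 0); split=> // i _; apply: subfield0.
  exists f; split; first exact: surj.
  by move=> i ltid; apply: BL; apply: funS.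
apply: (@sub_fin_span _ _ _ (adjoin (kfrob p k 1 L) (f @` `I_d))).
  exact: adjoinS.
apply: adjoin_fin_span => [|i ltid]; first exact: subfield_kfrob.
by rewrite -{2}[p]expn1; apply: frob_kfrob; apply: Bf.
Qed.

Lemma q_finite_lm_neq k K : is_subfield k -> is_subfield K -> k `<=` K ->
  purely_inseparable p k K -> unbounded_exponent p k K -> w0_generated p k K ->
  q_finite p k K -> lm p k K <> K.
Proof.
move=> sk sK kK piK uK wK [d [led _]] eqK.
have [n|m [im mm nm]] := @modular_subfield _ _ charp k K sk sK kK piK (p ^ d) _ uK wK.
  (* The layer 0 is [k], outside the range n >= 1 of [di_layers_le]. *)
  case: n => [|n].
    have sC : is_subfield (kfrob p k 1 k) by exact: subfield_kfrob.
    rewrite layer0 //; apply: (fin_span_leq sC (expp_gt0 charp d)).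
    exact: sub_fin_span (@sub_kfrob _ _ _ _ _) (basis_fin_span (has_basis_self sC)).
  have sL : is_subfield (layer p k K n.+1) by exact: subfield_layer.
  have kL : k `<=` layer p k K n.+1 by exact: sub_layer.
  have [B rB] := r_basis_exists sL kL.
  exact: r_basis_fin_span rB (led _ _ _ rB).
have [_ _ /(_ m im mm) lem] := lm_smallest charp sK kK.
by apply: nm; apply/seteqP; split; [have [] := im|rewrite -{1}eqK].
Qed.

End RBasis.

(** * Finiteness from modularity *)

Section Degree.
Variables (Omega : fieldType) (p : nat).
Hypothesis charp : p \in [pchar Omega].
Implicit Types (k m A B C F K L : set Omega).

(* Comparing [F' : k(F^p)] along the two towers through F and k(F'^p), and
   using [k(F'^p) : k(F^p)] <= [F' : F]. *)
Lemma free_kfrob_leq k F F' N D r (x : 'I_r -> Omega) :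
  is_subfield k -> is_subfield F -> is_subfield F' -> k `<=` F -> F `<=` F' ->
  purely_inseparable p k F' ->
  fin_span k F' N -> fin_span (kfrob p k 1 F') F' D ->
  (forall i, F (x i)) -> free_over (kfrob p k 1 F) x -> (r <= D)%N.
Proof.
move=> sk sF sF' kF FF' piF' fN fD Fx freex.
have [s _ bs] := fin_span_has_basis sF (fin_spanSl kF fN).
(* Needed to cancel s in the comparison of s * r with D * s. *)
have s0 : (0 < s)%N.
  case: s bs => // -[y [_ _ /(_ 1 (subfield1 sF'))[c _]]].
  by rewrite big_ord0 => /eqP; rewrite oner_eq0.
have [y [F'y freey F'span]] := bs.
have [w wbij] := ord_prod_bij s r.
have sG : is_subfield (kfrob p k 1 F) by exact: subfield_kfrob.
have freeyx : free_over (kfrob p k 1 F) (prodfam y x w).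
  by apply: free_prodfam freey freex => //; apply: kfrob_sub.
have [u F'u] := fin_span_tower fD
  (kfrob_fin_span charp 1 sk sF' piF' (basis_fin_span bs)).
rewrite -(leq_pmul2l s0) [leqRHS]mulnC; apply: (free_span_leq sG freeyx) => i.
by apply: F'u; apply: subfieldM => //; apply: FF'.
Qed.

End Degree.

(** * Layers of K over a field m with K/m modular *)

Section QFinite.
Variables (Omega : fieldType) (p : nat).
Hypothesis charp : p \in [pchar Omega].
Variables (k m K : set Omega).
Hypotheses (sk : is_subfield k) (sm : is_subfield m) (sK : is_subfield K).
Hypotheses (km : k `<=` m) (mK : m `<=` K).
Hypotheses (K_insep : purely_inseparable p k K).
Hypothesis K_unbounded : unbounded_exponent p k K.
Hypothesis K_w0 : w0_generated p k K.
Hypothesis mod_mK : modular p m K.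
Local Notation M := (layer p m K).

Let kK : k `<=` K.
Proof. exact: subset_trans km mK. Qed.

Let sM n : is_subfield (M n).
Proof. exact: subfield_layer. Qed.

Let mM n : m `<=` M n.
Proof. exact: sub_layer. Qed.

Let M_insep n : purely_inseparable p k (M n).
Proof. by move=> x /layer_sub; apply: K_insep. Qed.

(** If k(K^(p^j)) had exponent at most e over [k], K would have exponent at most j + e; so
    w_0-generation applies to it. *)
Lemma w0_kfrob j : kfrob p k j K = K.
Proof.
apply: (w0_generated_eq K_w0).
  by split; [exact: subfield_kfrob|exact: sub_kfrob|exact: kfrob_sub].
case=> e He; apply: K_unbounded; exists (j + e)%N => _ [x Kx <-].
by rewrite -frobX; apply: He; exists (x ^+ (p ^ j)) => //; apply: frob_kfrob.
Qed.

Let ld_m n : linearly_disjoint (frob_image p n K `&` m) m (frob_image p n K).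
Proof.
apply: linearly_disjoint_sym => //.
by apply: subfieldI => //; apply: subfield_frob_image.
Qed.

(** Write y = sum c_i z_i^(p^j) with c_i in [m], using K = k(K^(p^j)), and raise to the power p^n.
    Linear disjointness moves the scalars multiplying the c_i^(p^n) into both K^(p^(n+j)) and [m];
    their p^(n+j)-th roots then lie in M_(n+j), and taking p^n-th roots recovers y. *)
Lemma modular_layer_lspan n j :
  M n `<=` lspan m (frob_image p j (M (n + j))).
Proof.
move=> y [my Ky].
have : lspan m (frob_image p j K) y.
  move: Ky; rewrite -{1}(w0_kfrob j) (kfrob_lspan charp) //.
  exact: lspanS.
move=> /lspan_span[r [v [Kv [c mc eqy]]]].
have /choice[z zP] i : exists z, K z /\ z ^+ (p ^ j) = v i.
  by have [z Kz <-] := Kv i; exists z.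
have sB := subfield_frob_image (j + n) charp sK.
have [|||d Bd eqd] := linearly_disjoint_lincomb (a := fun i => c i ^+ (p ^ n))
    (y := y ^+ (p ^ n)) (subfieldI sB sm) sB (@subIsetl _ _ _) (@ld_m (j + n)%N).
- by move=> i; apply: subfieldX.
- exact: my.
- exists (fun i => z i ^+ (p ^ (j + n))) => [i|].
    by exists (z i) => //; apply: (zP i).1.
  rewrite eqy (frob_sum charp); apply: eq_bigr => i _.
  by rewrite exprMn -(zP i).2 frobX mulrC.
have /choice[w wP] i : exists w, K w /\ w ^+ (p ^ (j + n)) = d i.
  by have [[w Kw <-] _] := Bd i; exists w.
have -> : y = \sum_i c i * w i ^+ (p ^ j).
  apply: (frobI charp (n := n)); rewrite /= eqd (frob_sum charp).
  by apply: eq_bigr => i _; rewrite exprMn frobX (wP i).2 mulrC.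
apply: lspan_sum => // i; exists (w i) => //; split; last exact: (wP i).1.
by rewrite /frob_preimage /= addnC (wP i).2; have [] := Bd i.
Qed.

(* Otherwise an increasing union of finite extensions of m avoiding a fixed
   y in M 1 would be a proper subextension of unbounded exponent. *)
Lemma modular_layer1_finite : exists D, fin_span m (M 1) D.
Proof.
apply: contrapT => infM.
have [y [my Ky] nmy] : exists2 y, M 1 y & ~ m y.
  apply: contrapT => noy; apply: infM; exists 1%N.
  apply: sub_fin_span (basis_fin_span (has_basis_self sm)) => y My.
  by apply: contrapT => nmy; apply: noy; exists y.
pose I F := [/\ is_subfield F, m `<=` F, F `<=` K,
  exists N, fin_span m F N & ~ F y].
(* The premise [I NF.2] makes this hold for every pair, as [choice] requires; outside [I] any
   witness will do. *)
have step (NF : nat * set Omega) : exists F', I NF.2 ->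
    [/\ I F', NF.2 `<=` F' & exists2 x, F' x & ~ m (x ^+ (p ^ NF.1))].
  case: NF => N F /=; have [|nI] := pselect (I F); last by exists F.
  move=> [sF mF FK [r fr] nFy].
  have sFy : is_subfield (adjoin F [set y]) by exact: subfield_adjoin.
  have fFy : fin_span m (adjoin F [set y]) (p ^ 1 * r).
    apply: fin_span_tower fr; eexists; apply: (adjoin1_lspan charp) => //.
    exact: mF.
  (* Otherwise the p^N-th powers of M_(N+1) lie in F(y), and so does their [m]-span, which contains
     M_1; but F(y) is finite over [m]. *)
  have [x [mx Kx] nx] : exists2 x, M N.+1 x & ~ adjoin F [set y] (x ^+ (p ^ N)).
    apply: contrapT => nox; apply: infM; exists (p ^ 1 * r)%N.
    apply: sub_fin_span fFy; apply: subset_trans (@modular_layer_lspan 1 N) _.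
    apply: lspan_min => //; first by move=> z /mF; apply: sub_adjoinl.
    move=> _ [x Mx <-]; apply: contrapT => nx; apply: nox.
    by exists x.
  exists (adjoin F [set x]) => _; split.
  - split.
    + exact: subfield_adjoin.
    + by move=> z /mF; apply: sub_adjoinl.
    + by apply: adjoin_min => // _ ->.
    + exists (p ^ N.+1 * r)%N; apply: fin_span_tower fr.
      by eexists; apply: (adjoin1_lspan charp) => //; apply: mF.
    + by apply: (adjoin1_exchange charp sF _ nFy nx); apply: mF.
  - exact: sub_adjoinl.
  - exists x; first exact: sub_adjoinr.
    by apply: contra_not nx => /mF; apply: sub_adjoinl.
have [f fP] := choice step.
pose F := fix F n := if n is n'.+1 then f (n', F n') else m.
have IF n : I (F n).
  elim: n => [|n IHn] /=; last by have [] := fP (n, F n) IHn.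
  by split=> //; exists 1%N; apply: basis_fin_span (has_basis_self sm).
have leF a b : (a <= b)%N -> F a `<=` F b.
  move=> /subnK <-; elim: (b - a)%N => // j IHj.
  have [_ leS _] := fP ((j + a)%N, F (j + a)%N) (IF _).
  exact: subset_trans IHj leS.
apply: K_w0; exists (\bigcup_n F n); split.
- split.
  + by apply: subfield_bigcup => // n; have [] := IF n.
  + by move=> x /km mx; exists 0%N.
  + by move=> x [n _]; have [_ _ + _ _] := IF n; apply.
- move=> eqK; have : K y by [].
  by rewrite -eqK => -[n _]; have [] := IF n.
- case=> e He; have [_ _ [x Fx nmx]] := fP (e, F e) (IF e).
  by apply/nmx/km/He; exists x => //; exists e.+1.
Qed.

(** Frobenius sends a family in M_(n+1) free over M_n to a family in M_1 free over the intersection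
    of K^(p^n) and [m]. By modularity it is free over [m], hence has at most [D] members. *)
Lemma modular_layer_fin_span D n :
  fin_span m (M 1) D -> fin_span (M n) (M n.+1) D.
Proof.
move=> [u Mu].
have [r x Mx freex|r lerD br] := @bounded_free_has_basis _ (M n) (M n.+1) D (sM n).
  have free' : free_over m (fun i => x i ^+ (p ^ n)).
    apply: (mod_mK (n := n)) => [i|c Cc eqc i].
      by exists (x i) => //; apply: layer_sub (Mx i).
    have /choice[z zP] l : exists z, M n z /\ z ^+ (p ^ n) = c l.
      by have [[z Kz ezc] mc] := Cc l; exists z; split=> //; split=> //; rewrite /frob_preimage /= ezc.
    rewrite -(zP i).2 (freex z) ?(frob0 charp) // => [l|]; first exact: (zP l).1.
    apply: (frobI charp (n := n)); rewrite /= (frob_sum charp) (frob0 charp) -[RHS]eqc.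
    by apply: eq_bigr => l _; rewrite exprMn (zP l).2.
  apply: (free_span_leq sm free' (u := u)) => i; apply: Mu.
  by apply: frob_layer.
exact: fin_span_leq (sM n) lerD (basis_fin_span br).
Qed.

Lemma modular_layer_finite D n :
  fin_span m (M 1) D -> exists N, fin_span m (M n) N.
Proof.
move=> fD; elim: n => [|n [N fN]].
  by rewrite layer0 //; exists 1%N; apply: basis_fin_span (has_basis_self sm).
exists (D * N)%N; apply: fin_span_tower fN; exact: modular_layer_fin_span.
Qed.

Variable e : nat.
Hypothesis me : frob_image p e m `<=` k.

Lemma kfrob_modular_layer_finite D n :
  fin_span m (M 1) D -> exists N, fin_span k (kfrob p k e (M n)) N.
Proof.
move=> /(@modular_layer_finite _ n)[N fN]; exists N.
apply: fin_spanSl (kfrob_fin_span charp e sk (sM n) (@M_insep n) fN).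
by apply: kfrob_min => // x mx; apply: me; exists x.
Qed.

(** The degree of k(M_(n+1)^(p^e)) over k(M_n^(p^e)) is at most [D], and the latter lies in
    k(M_(n+1)^(p^(e+1))) because M_n = m(M_(n+1)^p) and m^(p^e) is in [k]. *)
Lemma kfrob_modular_layer_fin_span D n : fin_span m (M 1) D ->
  fin_span (kfrob p k 1 (kfrob p k e (M n.+1))) (kfrob p k e (M n.+1)) D.
Proof.
move=> /(@modular_layer_fin_span _ n) fD.
apply: fin_spanSl (kfrob_fin_span charp e sk (sM n.+1) (@M_insep n.+1) fD).
rewrite (kfrobD charp) //.
have sE : is_subfield (kfrob p k (e + 1) (M n.+1)) by exact: subfield_kfrob.
apply: kfrob_min => //; first exact: sub_kfrob.
move=> x /(@modular_layer_lspan n 1).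
apply: (@lspan_min _ _ _ (frob_preimage p e (kfrob p k (e + 1) (M n.+1)))).
- exact: subfield_frob_preimage.
- by move=> z mz; apply: sub_kfrob; apply: me; exists z.
- move=> _ [z Mz <-]; rewrite /frob_preimage /= frobX addnC.
  by apply: frob_kfrob; rewrite -addn1.
Qed.

(** K = k(K^(p^e)) is the increasing union of the k(M_N^(p^e)), so finitely many elements lie in one
    of them. *)
Lemma kfrob_modular_layer_cover r (x : 'I_r -> Omega) :
  (forall i, K (x i)) -> exists N, forall i, kfrob p k e (M N.+1) (x i).
Proof.
move=> Kx; pose U := \bigcup_N kfrob p k e (M N).
have leU a b : (a <= b)%N -> kfrob p k e (M a) `<=` kfrob p k e (M b).
  by move=> leab; apply: kfrobS => //; apply: layerS.
have sU : is_subfield U.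
  by apply: subfield_bigcup => // N; apply: subfield_kfrob.
have KU : K `<=` U.
  rewrite -{1}(w0_kfrob e); apply: kfrob_min => //.
    by move=> z kz; exists 0%N => //; apply: sub_kfrob.
  move=> z Kz; have [n kz] := K_insep Kz; exists n => //; apply: frob_kfrob.
  by split=> //; apply: km.
have /choice[f fP] i : exists N, kfrob p k e (M N) (x i).
  by have [N _ UN] := KU _ (Kx i); exists N.
exists (\max_i f i)%N => i; apply: leU (fP i).
by apply: leqW; apply: (@leq_bigmax _ f i).
Qed.

(** From more than [D] elements of [B] pick D+1 and let F be the field they generate over [k]. They
    are free over k(F^p), and F lies in some k(M_(N+1)^(p^e)), so [free_kfrob_leq] gives D+1 <=
    D. *)
Lemma modular_di_layers_le D : fin_span m (M 1) D -> di_layers_le p k K `I_D.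
Proof.
move=> fD n n0 B rB; have [BL eqL indB] := rB.
have sL : is_subfield (layer p k K n) by exact: subfield_layer.
have kL : k `<=` layer p k K n by exact: sub_layer.
apply: contrapT => nBD.
have [b [bB bI]] : exists b : 'I_D.+1 -> Omega, (forall i, B (b i)) /\ injective b.
  have : `I_D.+1 #<= B.
    have [[r Br]|infB] := pselect (finite_set B).
      rewrite (card_le_eqr Br) card_le_II ltnNge; apply/negP => lerD; apply: nBD.
      by rewrite (card_le_eql Br) card_le_II.
    by apply: card_le_trans (proj1 (infiniteP _) infB); apply: subset_card_le.
  move=> /pfcard_geP[I0|[f]].
    by have : (`I_D.+1 : set nat) 0%N by []; rewrite I0.
  have /choice[b bP] (i : 'I_D.+1) : exists x, B x /\ f x = i.
    by have [x Bx fx] := 'surj_f (ltn_ord i); exists x.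
  exists b; split=> [i|i j eqb]; first exact: (bP i).1.
  by apply: val_inj; rewrite /= -(bP i).2 eqb (bP j).2.
have bL i : layer p k K n (b i) by apply: BL.
pose F := adjoin k (range b).
have sF : is_subfield F by exact: subfield_adjoin.
have kF : k `<=` F by exact: sub_adjoinl.
have Fb i : F (b i) by apply: sub_adjoinr; exists i.
have FL : F `<=` layer p k K n by apply: adjoin_min => // _ [i _ <-].
have [N bN] := kfrob_modular_layer_cover (fun i => (bL i).2).
set F' := kfrob p k e (M N.+1) in bN.
have sF' : is_subfield F' by exact: subfield_kfrob.
have FF' : F `<=` F'.
  by apply: adjoin_min => //; [exact: sub_kfrob|move=> _ [i _ <-]].
have piF' : purely_inseparable p k F'.
  by move=> x /(kfrob_sub (sM _) (subset_trans km (@mM _)))/M_insep.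
have [N' fN'] := @kfrob_modular_layer_finite _ N.+1 fD.
suff: (D.+1 <= D)%N by rewrite ltnn.
apply: (free_kfrob_leq charp sk sF sF' kF FF' piF' fN' _ Fb).
  exact: kfrob_modular_layer_fin_span.
(* A nontrivial relation over k(F^p) would express one [b i] through the others over k(K_n^p),
   against the independence of [B]. *)
set C := kfrob p k 1 F.
have CL : C `<=` kfrob p k 1 (layer p k K n) by exact: kfrobS.
have sC : is_subfield C by exact: subfield_kfrob.
move=> c Cc eqc i; apply/eqP/negPn/negP => ci.
apply: (indB (b i) (bB i)).
set E := adjoin _ _; have sE : is_subfield E by exact: subfield_adjoin.
have eb : b i = \sum_l - (c (lift i l) / c i) * b (lift i l).
  under eq_bigr do rewrite mulNr mulrAC.
  rewrite sumrN -mulr_suml; apply: (mulfI ci).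
  rewrite mulrN mulrCA divff // mulr1; apply/eqP; rewrite -addr_eq0.
  by rewrite -[X in _ == X]eqc (bigD1_ord i).
suff : E (\sum_l - (c (lift i l) / c i) * b (lift i l)) by rewrite -eb.
apply: (subfield_sum sE) => l; apply: (subfieldM sE).
  apply: (subfieldN sE); apply: sub_adjoinl.
  exact: CL (subfield_div sC (Cc _) (Cc _)).
apply: sub_adjoinr; split=> // /bI/eqP.
by rewrite eq_sym (negPf (neq_lift _ _)).
Qed.

End QFinite.

(** * The converse implication and the equivalence *)

Section Conclusion.
Variables (Omega : fieldType) (p : nat).
Hypothesis charp : p \in [pchar Omega].
Implicit Types (k K : set Omega).

(** The least natural bound is the supremum: it is minimal among finite cardinals, and every
    infinite one exceeds it. *)
Lemma di_layers_le_q_finite k K D : di_layers_le p k K `I_D -> q_finite p k K.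
Proof.
move=> leD; pose P d := `[< di_layers_le p k K `I_d >].
have exP : exists d, P d by exists D; apply/asboolP.
case: (ex_minnP exP) => d /asboolP led mind; exists d; split=> // U E leE.
have [[r Er]|infE] := pselect (finite_set E).
  rewrite (card_le_eqr Er) card_le_II; apply: mind; apply/asboolP => n n0 B rB.
  by rewrite -(card_le_eqr Er); apply: leE rB.
by apply: card_le_trans (proj1 (infiniteP _) infE); apply: subset_card_le.
Qed.

Lemma lm_neq_q_finite k K : is_subfield k -> is_subfield K -> k `<=` K ->
  purely_inseparable p k K -> unbounded_exponent p k K -> w0_generated p k K ->
  lm p k K <> K -> q_finite p k K.
Proof.
move=> sk sK kK piK uK wK nlm.
have [[sm km mK] modm _] := lm_smallest charp sK kK.
(* A proper intermediate field has bounded exponent by w_0-generation. *)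
have [e me] : bounded_exponent p k (lm p k K).
  by apply: contrapT => um; apply: wK; exists (lm p k K).
have [D fD] := modular_layer1_finite charp sk sm sK km mK piK uK wK modm.
apply: di_layers_le_q_finite.
exact: (modular_di_layers_le charp sk sm sK km mK piK uK wK modm me fD).
Qed.

End Conclusion.

Theorem mainTheorem1 (p : nat) (Omega : closedFieldType)
    (charp : p \in [pchar Omega]) (k K : set Omega)
    (k_subfield : is_subfield k)
    (Omega_closure : forall x : Omega, algebraic_over k x)
    (K_subfield : is_subfield K) (k_sub_K : k `<=` K)
    (K_insep : purely_inseparable p k K)
    (K_unbounded : unbounded_exponent p k K)
    (K_w0 : w0_generated p k K) :
  q_finite p k K <-> lm p k K <> K.
Proof.
by split; [exact: q_finite_lm_neq|exact: lm_neq_q_finite].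
Qed.
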